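(* Let $G$ be a locally compact, second countable Hausdorff topological group which acts transitively on $\Sigma\cong G/H$, a locally compact second countable topological space with Borel $\sigma$-algebra $\mathrm{Bor}(\Sigma)$, where $H$ is a closed subgroup of $G$. Let $\mu$ be a quasi-invariant $\sigma$-finite positive Borel measure on $\Sigma$. If $\mathsf E:\mathrm{Bor}(\Sigma)\to\mathcal E(\mathcal H)$ is a $G$-covariant normalized POVM, then $\mathsf E\ll\mu$, i.e. $\mu(\Delta)=0\Rightarrow \mathsf E(\Delta)=0$ for all $\Delta\in\mathrm{Bor}(\Sigma)$, and for every trace-class operator $\chi\in\mathcal T(\mathcal H)$ the complex measure $\mu^{\mathsf E}_\chi$ has a Radon–Nikodym derivative $\frac{d\mu^{\mathsf E}_\chi}{d\mu}\in L^1(\Sigma;\mu)$. Moreover, if $\chi\ge 0$ then $\frac{d\mu^{\mathsf E}_\chi}{d\mu}\ge 0$, and if $\mathrm{Tr}[\chi]=1$ then $\int_\Sigma \frac{d\mu^{\mathsf E}_\chi}{d\mu}\,d\mu=1$.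
   Context: $\mathcal H$ is a complex separable Hilbert space, $\mathcal T(\mathcal H)$ is the space of trace-class operators on $\mathcal H$, and $\mathcal E(\mathcal H)$ is the set of effects (operators $0\le E\le \mathbb 1$) on $\mathcal H$. The action of $G$ on $\Sigma$ is continuous. A POVM $\mathsf E:\mathrm{Bor}(\Sigma)\to\mathcal E(\mathcal H)$ is an ultraweakly countably additive map with $\mathsf E(\emptyset)=0$; it is normalized if $\mathsf E(\Sigma)=\mathbb 1$. It is $G$-covariant if there is an ultraweakly continuous unitary representation $U:G\to\mathcal U(\mathcal H)$ with $U(g)\mathsf E(\Delta)U(g)^\dagger=\mathsf E(g\cdot\Delta)$ for all $g\in G$, $\Delta\in\mathrm{Bor}(\Sigma)$. For $\chi\in\mathcal T(\mathcal H)$, $\mu^{\mathsf E}_\chi(\Delta):=\mathrm{Tr}[\chi\,\mathsf E(\Delta)]$. A measure $\mu$ on $\Sigma$ is quasi-invariant if for all $g\in G$ and $X\in\mathrm{Bor}(\Sigma)$: $\mu(g\cdot X)=0\Leftrightarrow\mu(X)=0$.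
   Formalization: The measure μ is additionally assumed to be nonzero; for μ = 0 (which is quasi-invariant and σ-finite) the claim would force E(Σ) = 0, contradicting normalization E(Σ) = 1 unless the Hilbert space is zero. *)

(* Defs.v *)
From HB Require Import structures.
From mathcomp Require Import all_boot all_order all_algebra.
From mathcomp Require Import all_classical all_reals all_analysis.
From mathcomp Require Import complex.
Import Order.TTheory GRing.Theory Num.Theory.
Import numFieldNormedType.Exports.

Set Implicit Arguments.
Unset Strict Implicit.
Unset Printing Implicit Defensive.

Local Open Scope classical_set_scope.
Local Open Scope ring_scope.
Local Open Scope complex_scope.

(* The field [R[i]], whose topology is only found through its [numFieldType]
   structure, as a normed module over itself. *)
HB.instance Definition _ (R : realType) :=
  NormedModule.copy R[i] (R[i] : numClosedFieldType).

(** * Complex Hilbert spaces and operators *)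

(* The inner product is linear in its first argument, so that the physicists'
   <x | T y> is ['[T y, x]]. *)
HB.mixin Record CompleteNormedModule_isHilbert (R : realType) H
    of CompleteNormedModule R[i] H := {
  inner : {dot H for (@Num.conj R[i])};
  innerxx : forall x : H, inner x x = `|x| ^+ 2
}.

#[short(type="hilbertType")]
HB.structure Definition Hilbert (R : realType) :=
  {H of CompleteNormedModule_isHilbert R H & CompleteNormedModule R[i] H}.

Notation "'[ x , y ]" := (inner x y) : ring_scope.

Definition separable (T : topologicalType) :=
  exists2 D : set T, countable D & dense D.

Section Operators.
Context {R : realType} {H : hilbertType R}.
Implicit Types (A B P T : H -> H) (D : pred nat) (e : nat -> H).

Definition bounded_op A := linear A /\ continuous A.

(* The adjoint is characterized by its defining identity; it is junk when no
   function satisfies it, which never happens for a bounded operator. *)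
Definition adjoint A : H -> H :=
  get [set B : H -> H | forall x y, '[A x, y] = '[x, B y]].

Definition unitary_op A :=
  [/\ bounded_op A, adjoint A \o A = idfun & A \o adjoint A = idfun].

(* The order of [R[i]] makes [a <= b] entail that [b - a] is real. *)
Definition le_op A B := forall x, '[A x, x] <= '[B x, x].

Definition positive_op A := le_op (fun=> 0) A.

Definition effect A := [/\ bounded_op A, positive_op A & le_op A idfun].

(* [P] is |T|, the positive square root of T^* T. *)
Definition is_abs_op T P :=
  [/\ bounded_op P, positive_op P & P \o P = adjoint T \o T].

(* The basis vectors are the [e n] for [n] satisfying [D]; a finite [D] gives
   the bases of finite-dimensional spaces. *)
Definition orthonormal_basis D e :=
  (forall m n, D m -> D n -> '[e m, e n] = (m == n)%:R) /\
  (forall x, (\sum_(0 <= k < n | D k) '[x, e k] *: e k) @[n --> \oo] --> x).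

Definition trace_class T :=
  bounded_op T /\
  exists2 P, is_abs_op T P &
  exists D e, orthonormal_basis D e /\
    (\sum_(0 <= k <oo | D k) (complex.Re '[P (e k), e k])%:E < +oo)%E.

(* The common value of the sums of the diagonal coefficients of [T] over all
   orthonormal bases. *)
Definition trace T : R[i] :=
  get [set t : R[i] | forall D e, orthonormal_basis D e ->
    (\sum_(0 <= k < n | D k) '[T (e k), e k]) @[n --> \oo] --> t].

(* Convergence in the topology induced by the functionals A |-> Tr[T A]. *)
Definition ultraweak_cvg {I : Type} (F : set_system I)
    (A : I -> H -> H) (L : H -> H) :=
  forall T, trace_class T -> trace (T \o A i) @[i --> F] --> trace (T \o L).

End Operators.

(** * Topological groups and homogeneous spaces *)

HB.mixin Record Topological_Group_isTopologicalGroup G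
    of Topological G & Group G := {
  mulg_continuous : continuous (fun x : G * G => (x.1 * x.2)%g);
  invg_continuous : continuous (fun x : G => (x^-1)%g)
}.

#[short(type="topologicalGroupType")]
HB.structure Definition TopologicalGroup :=
  {G of Topological_Group_isTopologicalGroup G & Topological G & Group G}.

Section Cosets.
Variables (G : topologicalGroupType) (K : groupClosed G).

Definition lcoset_rel (x y : G) : bool := (x^-1 * y)%g \in K.

Lemma lcoset_rel_refl : reflexive lcoset_rel.
Proof. by move=> x; rewrite /lcoset_rel mulVg gpred1. Qed.

Lemma lcoset_rel_sym : symmetric lcoset_rel.
Proof. by move=> x y; rewrite /lcoset_rel -gpredV invgM invgK. Qed.

Lemma lcoset_rel_trans : transitive lcoset_rel.
Proof.
move=> y x z xy yz; rewrite /lcoset_rel -(mulVKg y z) mulgA.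
exact: gpredM.
Qed.

Definition lcoset_equiv :=
  EquivRel lcoset_rel lcoset_rel_refl lcoset_rel_sym lcoset_rel_trans.

Definition lcoset_space : topologicalType :=
  quotient_topology {eq_quot lcoset_equiv}%qT.

Definition lcoset_pi (x : G) : lcoset_space := \pi_(lcoset_space)%qT x.

End Cosets.

Definition continuous_action (G : topologicalGroupType) (S : topologicalType)
    (act : G -> S -> S) :=
  [/\ forall x, act 1%g x = x,
      forall g h x, act (g * h)%g x = act g (act h x) &
      continuous (fun p : G * S => act p.1 p.2)].

Definition transitive_action (G S : Type) (act : G -> S -> S) :=
  forall x y, exists g, act g x = y.

(* [S] is isomorphic to G/K as a topological G-space. *)
Definition isomorphic_to_cosets (G : topologicalGroupType) (K : groupClosed G)
    (S : topologicalType) (act : G -> S -> S) :=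
  exists (f : lcoset_space K -> S) (f' : S -> lcoset_space K),
    [/\ continuous f, continuous f', cancel f f', cancel f' f &
        forall g x, f (lcoset_pi K (g * x)%g) = act g (f (lcoset_pi K x))].

Notation borel S := (g_sigma_algebraType (@open S)).

Definition quasi_invariant (R : realType) (G : Type) (S : ptopologicalType)
    (act : G -> S -> S) (mu : set (borel S) -> \bar R) :=
  forall g (X : set (borel S)), measurable X ->
    mu (act g @` X) = 0%E <-> mu X = 0%E.

(** * Covariant POVMs *)

Section POVM.
Context {R : realType} {H : hilbertType R} {S : ptopologicalType}.
Variable E : set (borel S) -> H -> H.

Definition povm :=
  [/\ forall X, measurable X -> effect (E X),
      E set0 = (fun=> 0) &
      forall X : nat -> set (borel S),
        (forall n, measurable (X n)) -> trivIset setT X ->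
        ultraweak_cvg \oo (fun n x => \sum_(0 <= k < n) E (X k) x)
          (E (\bigcup_n X n))].

Definition normalized_povm := povm /\ E setT = idfun.

Definition ultraweak_unitary_rep (G : topologicalGroupType) (U : G -> H -> H) :=
  [/\ forall g, unitary_op (U g),
      U 1%g = idfun,
      forall g h, U (g * h)%g = U g \o U h &
      forall g, ultraweak_cvg (nbhs g) U (U g)].

Definition covariant (G : topologicalGroupType) (act : G -> S -> S) :=
  exists2 U : G -> H -> H, ultraweak_unitary_rep U &
    forall g X, measurable X -> U g \o E X \o adjoint (U g) = E (act g @` X).

Definition povm_measure (chi : H -> H) (X : set (borel S)) : R[i] :=
  trace (chi \o E X).

End POVM.

(** * Complex-valued integration *)

Section ComplexIntegral.
Context {d} {T : measurableType d} {R : realType}.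
Variable mu : {measure set T -> \bar R}.

Definition complex_integrable (f : T -> R[i]) :=
  mu.-integrable setT (fun x => (complex.Re (f x))%:E) /\
  mu.-integrable setT (fun x => (complex.Im (f x))%:E).

Definition complex_integral (A : set T) (f : T -> R[i]) : R[i] :=
  (\int[mu]_(x in A) complex.Re (f x)) +i*
  (\int[mu]_(x in A) complex.Im (f x)).

(* [f] is an integrable function representing d nu / d mu; such an [f] is only
   determined up to a mu-negligible set. *)
Definition is_RN_derivative (nu : set T -> R[i]) (f : T -> R[i]) :=
  complex_integrable f /\
  forall A, measurable A -> nu A = complex_integral A f.

End ComplexIntegral.

(* Main.v *)
Require Import Defs.
From HB Require Import structures.
From mathcomp Require Import all_boot all_order all_algebra.
From mathcomp Require Import all_classical all_reals all_analysis.
From mathcomp Require Import complex measurable_realfun.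
From mathcomp Require Import ring lra.

(** A quasi-invariant measure on a transitive [G]-space is determined up to
    equivalence. Let [mu X = 0]. Quasi-invariance gives [mu (g X) = 0] for all
    [g], so by Fubini with a Haar measure [h] of [G], the set of the [g] such
    that [g^-1 s \in X] is [h]-null for almost every [s]; by transitivity and
    left invariance this holds for every [s]. Fubini with [<E(.) x, x>] in place
    of [mu] gives [<E(g X) x, x> = 0] for almost every [g], hence, for a common
    [g], for all [x] in a countable dense set. So [E(g X) = 0], and [E(X)] is
    unitarily equivalent to it.

    The Haar measure is obtained from ultralimits of ratios of covering numbers.
    A trace-class [T] is written as [sum_j <., w_j> v_j] with
    [sum_j |v_j| |w_j|] finite, by Gram-Schmidt with respect to [<|T| ., .>];
    then [Tr (T A) = sum_j <A v_j, w_j>] for every bounded [A], which makes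
    [Tr (T E(.))] a complex measure to which Radon-Nikodym applies. *)

Set Implicit Arguments.
Unset Strict Implicit.
Unset Printing Implicit Defensive.

Import Order.TTheory GRing.Theory Num.Theory.
Import numFieldNormedType.Exports.
Local Open Scope classical_set_scope.
Local Open Scope ring_scope.
Local Open Scope complex_scope.

(** * Haar measure *)

(** Fubini needs a reference measure on [G] that is sigma-finite and nonzero and whose null sets are
    left invariant; second countability also makes the map sending [(g, s)] to [g^-1 s] measurable
    for the product of the Borel sigma-algebras. The null set of exceptional [g] depends on the
    vector [x], so only countably many vectors can be treated at once; boundedness of [E (g X)] then
    extends the vanishing to all of [H]. [trace] is a value chosen to be common to all orthonormal
    bases, whereas [trace_class] bounds a sum in a single basis. The decomposition of [T] bridges
    the two, since its series for [Tr (T A)] converges absolutely and mentions no basis. The form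
    [<|T| ., .>] may be degenerate, so the orthogonalization controls vectors only after [|T|] is
    applied to them. *)

(* [measurableType] structures are only available on pointed types. *)
Definition pgroup (G : topologicalGroupType) : Type := G.

HB.instance Definition _ (G : topologicalGroupType) :=
  TopologicalGroup.on (pgroup G).
HB.instance Definition _ (G : topologicalGroupType) :=
  isPointed.Build (pgroup G) (1%g : G).

Section TopologicalGroupTheory.
Context {G : topologicalGroupType}.

Lemma nbhs_mulg (x y : G) (O : set G) : nbhs (x * y)%g O ->
  exists A B, [/\ nbhs x A, nbhs y B & forall a b, A a -> B b -> O (a * b)%g].
Proof.
move=> /(mulg_continuous (x, y))[[A B]] /= [nA nB] AB.
by exists A, B; split=> // a b Aa Bb; exact: (AB (a, b)).
Qed.

Lemma mulgl_continuous (g : G) : continuous (fun x : G => g * x)%g.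
Proof.
move=> x O /nbhs_mulg[A [B [nA nB AB]]]; apply: filterS nB => b Bb.
by apply: AB => //; exact: nbhs_singleton.
Qed.

Lemma mulgr_continuous (g : G) : continuous (fun x : G => x * g)%g.
Proof.
move=> x O /nbhs_mulg[A [B [nA nB AB]]]; apply: filterS nA => b Bb.
by apply: AB => //; exact: nbhs_singleton.
Qed.

Lemma nbhs_divgl (x : G) (V : set G) : nbhs 1%g V ->
  nbhs x [set y | V (y^-1 * x)%g].
Proof.
move=> V1; have : nbhs (x^-1 * x)%g V by rewrite mulVg.
move/(mulgr_continuous (g:=x) (x:=(x^-1)%g)).
exact: invg_continuous.
Qed.

Lemma nbhs_translate (x : G) (V : set G) : nbhs 1%g V ->
  nbhs x [set y | V (x^-1 * y)%g].
Proof.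
move=> V1; have : nbhs (x^-1 * x)%g V by rewrite mulVg.
exact: mulgl_continuous.
Qed.

(** Compactness along the product of the two filters yields a finite subcover and a uniform
    neighbourhood at once, as a Lebesgue number would. A constant family [O] separates [C] from a
    disjoint closed set. *)
Lemma compact_uniform_cover (C : set G) (O : nat -> set G) :
  compact C -> (forall n, open (O n)) -> C `<=` \bigcup_n O n ->
  \forall n \near \oo & V \near powerset_filter_from (nbhs (1%g : G)),
    forall x, C x -> exists2 i, (i < n)%N & forall v, V v -> O i (x * v)%g.
Proof.
move=> /compact_near_coveringP cC oO CO.
pose P (nV : nat * set G) (x : G) :=
  exists2 i, (i < nV.1)%N & forall v, nV.2 v -> O i (x * v)%g.
have := cC _ (filter_prod \oo (powerset_filter_from (nbhs (1%g : G)))) P.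
apply => x /CO[i _ Oix].
have [] := @nbhs_mulg x 1%g (O i); first by rewrite mulg1; exact: open_nbhs_nbhs.
move=> A [B [nA nB AB]].
exists (A, [set nV : nat * set G | (i < nV.1)%N /\ nV.2 `<=` B]) => /=.
  split=> //.
  exists ([set n | i < n]%N, [set V | V `<=` B]) => /=.
    split; first by exists i.+1.
    exact: small_set_sub.
  by move=> [n V] [].
move=> [y [n V]] /= [Ay [ni VB]]; exists i => //= v Vv.
exact/AB/VB.
Qed.

End TopologicalGroupTheory.

(** * Covering numbers by translates of a neighbourhood *)

Section CoveringNumber.
Context {G : topologicalGroupType}.
Implicit Types (A B V : set G) (s : seq G).

Definition covers A V s := A `<=` [set x | exists2 g, g \in s & V (g^-1 * x)%g].


Let has_cover A V n := `[< exists2 s, covers A V s & size s = n >].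

(* Junk value [0] when no finite cover exists. *)
Definition covnum A V : nat :=
  if pselect (exists n, has_cover A V n) is left h then ex_minn h else 0.

Lemma covnumP A V s : covers A V s ->
  exists2 s', covers A V s' & size s' = covnum A V.
Proof.
move=> sAV; rewrite /covnum; case: pselect => [h|[]]; last first.
  by exists (size s); apply/asboolP; exists s.
by case: ex_minnP => n /asboolP.
Qed.

Lemma covnum_le A V s : covers A V s -> (covnum A V <= size s)%N.
Proof.
move=> sAV; rewrite /covnum; case: pselect => [h|//].
by case: ex_minnP => n _; apply; apply/asboolP; exists s.
Qed.

Lemma coversS A B V s : A `<=` B -> covers B V s -> covers A V s.
Proof. by move=> AB; apply: subset_trans. Qed.

Lemma covers_translate A V s g : covers A V s ->
  covers [set x | A (g^-1 * x)%g] V [seq (g * h)%g | h <- s].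
Proof.
move=> sAV x /= /sAV[h hs Vh]; exists (g * h)%g; first exact: map_f.
by rewrite invgM -mulgA.
Qed.

Lemma covers_cat A B V s s' : covers A V s -> covers B V s' ->
  covers (A `|` B) V (s ++ s').
Proof.
by move=> sA sB x [/sA|/sB] [g gs Vg]; exists g; rewrite // mem_cat gs ?orbT.
Qed.

Lemma covers_trans A B V s s' : covers A B s -> covers B V s' ->
  covers A V [seq (g * h)%g | g <- s, h <- s'].
Proof.
move=> sA sB x /sA[g gs /sB[h hs Vh]]; exists (g * h)%g.
  by apply/allpairsP; exists (g, h).
by rewrite invgM -mulgA.
Qed.

Lemma compact_covers A V : compact A -> nbhs 1%g V -> exists s, covers A V s.
Proof.
move=> cA V1; have : @cover_compact (pgroup G) A by rewrite -compact_cover.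
move=> {}cA; have [|x Ax|s _ sA] := cA G setT (fun g => [set x | V (g^-1 * x)%g]°).
- by move=> g _; exact: open_interior.
- by exists x => //; exact: nbhs_translate.
exists (finmap.enum_fset s) => x /sA[g /= gs] /interior_subset Vg; by exists g.
Qed.

Lemma covnumS A B V s : A `<=` B -> covers B V s ->
  (covnum A V <= covnum B V)%N.
Proof.
move=> AB /covnumP[s' sB <-]; apply: covnum_le; exact: coversS sB.
Qed.

Lemma covnum_translate A V s g : covers A V s ->
  (covnum [set x | A (g^-1 * x)%g] V <= covnum A V)%N.
Proof.
move=> /covnumP[s' sA <-]; rewrite -(size_map (fun h => g * h)%g).
exact/covnum_le/covers_translate.
Qed.

Lemma covnumU A B V s s' : covers A V s -> covers B V s' ->
  (covnum (A `|` B) V <= covnum A V + covnum B V)%N.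
Proof.
move=> /covnumP[t tA <-] /covnumP[t' tB <-]; rewrite -size_cat.
exact/covnum_le/covers_cat.
Qed.

(** The products of the centres of the two covers are the new centres. With [B] the reference set
    [A0], this bounds the covering ratios independently of [V]. *)
Lemma covnum_trans A B V s s' : covers A B s -> covers B V s' ->
  (covnum A V <= covnum A B * covnum B V)%N.
Proof.
move=> /covnumP[t tA <-] /covnumP[t' tB <-]; rewrite -(size_allpairs (fun g h => g * h)%g).
exact: covnum_le (covers_trans tA tB).
Qed.

(* A translate of [V] meeting both [A] and [B] would give [a v^-1 w = b]. *)
Lemma covnumU_ge A B V s : covers (A `|` B) V s ->
  (forall a v w, A a -> V v -> V w -> ~ B (a * (v^-1 * w))%g) ->
  (covnum A V + covnum B V <= covnum (A `|` B) V)%N.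
Proof.
move=> /covnumP[t tAB <-] AVB.
pose P g := `[< exists2 v, V v & A (g * v)%g >].
rewrite -(count_predC P t) -!size_filter; apply: leq_add; apply: covnum_le.
- move=> x Ax; have [g gt Vg] := tAB x (or_introl Ax).
  exists g => //; rewrite mem_filter gt andbT; apply/asboolP.
  by exists (g^-1 * x)%g => //; rewrite mulVKg.
- move=> x Bx; have [g gt Vg] := tAB x (or_intror Bx).
  exists g => //; rewrite mem_filter gt andbT /=; apply/asboolP => -[v Vv Agv].
  by apply: (AVB _ _ _ Agv Vv Vg); rewrite mulgA mulgK mulVKg.
Qed.

Lemma covnum_gt0 A V s : A !=set0 -> covers A V s -> (0 < covnum A V)%N.
Proof.
by move=> [x Ax] /covnumP[[|g t] tA <-] //; have [? ] := tA _ Ax.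
Qed.

End CoveringNumber.

Lemma ler_lim_filter {T : Type} {F : set_system T} {FF : ProperFilter F}
    {R : realFieldType} (f g : T -> R) :
  cvg (f x @[x --> F]) -> cvg (g x @[x --> F]) ->
  (\forall x \near F, f x <= g x) ->
  lim (f x @[x --> F]) <= lim (g x @[x --> F]).
Proof.
move=> cf cg fg; rewrite -subr_ge0 -limB//; apply: limr_ge; first exact: is_cvgB.
by apply: filterS fg => x; rewrite subr_ge0.
Qed.

(** * Haar content and the outer measure it generates *)

Section HaarContent.
Context {R : realType} {G : topologicalGroupType}.
Variables (A0 : set G) (U : set_system (set G)).
Hypotheses (A0c : compact A0) (A01 : nbhs 1%g A0).
Hypotheses (UU : UltraFilter U) (U1 : powerset_filter_from (nbhs (1%g : G)) `<=` U).
Implicit Types (A B C V : set G).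

Definition covratio A V : R := (covnum A V)%:R / (covnum A0 V)%:R.

(** An ultrafilter finer than the filter of small neighbourhoods selects limits for all compact sets
    simultaneously, and inequalities between covering numbers pass to these limits. *)
Definition haar_content A : R := lim (covratio A V @[V --> U]).

#[local] Instance ultra_proper_local : ProperFilter U := ultra_proper.

Let U_nbhs : \forall V \near U, nbhs 1%g V.
Proof. by apply: U1; exact: near_small_set. Qed.

Let covA0_gt0 : \forall V \near U, 0 < (covnum A0 V)%:R :> R.
Proof.
apply: filterS U_nbhs => V V1; rewrite ltr0n.
have [s sA0] := compact_covers A0c V1.
by apply: covnum_gt0 sA0; exists 1%g; exact: nbhs_singleton.
Qed.

Lemma covratio_ge0 A V : 0 <= covratio A V.
Proof. by rewrite divr_ge0. Qed.

(** [covnum_trans] keeps the ratio between [0] and [covnum C A0]; by compactness it has a cluster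
    point along [U], and for an ultrafilter a cluster point is a limit. *)
Lemma covratio_cvg C : compact C -> cvg (covratio C V @[V --> U]).
Proof.
move=> cC; pose M : R := (covnum C A0)%:R.
have rM : \forall V \near U, `[0, M]%classic (covratio C V).
  apply: filterS (filterI U_nbhs covA0_gt0) => V [V1 A0V].
  rewrite /= in_itv /= covratio_ge0 /= ler_pdivrMr// -natrM ler_nat.
  have [s sC] := compact_covers cC A01; have [t tA] := compact_covers A0c V1.
  exact: covnum_trans sC tA.
have [p [_ clp]] := @segment_compact R 0 M _ (fmap_proper_filter _ _) rM.
apply/cvg_ex; exists p => B nB.
have [//|UnB] := in_ultra_setVsetC (covratio C @^-1` B) UU.
by have [q []] := clp (~` B) B UnB nB.
Qed.

Lemma haar_contentS C D : compact C -> compact D -> C `<=` D ->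
  haar_content C <= haar_content D.
Proof.
move=> cC cD CD; rewrite /haar_content; apply: ler_lim_filter; [exact: covratio_cvg..|].
apply: filterS U_nbhs => V V1; rewrite ler_wpM2r// ler_nat.
by have [s sD] := compact_covers cD V1; exact: covnumS sD.
Qed.

Lemma haar_contentU C D : compact C -> compact D ->
  haar_content (C `|` D) <= haar_content C + haar_content D.
Proof.
move=> cC cD; rewrite /haar_content -limD; [|exact: covratio_cvg..].
apply: ler_lim_filter.
- exact/covratio_cvg/compactU.
- by apply: is_cvgD; exact: covratio_cvg.
apply: filterS U_nbhs => V V1 /=; rewrite -mulrDl ler_wpM2r// -natrD ler_nat.
have [s sC] := compact_covers cC V1; have [t tD] := compact_covers cD V1.
exact: covnumU sC tD.
Qed.

(** Once [V] is small, none of its translates meets both [C] and [D], so [covnumU_ge] applies to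
    [U]-almost every [V]. *)
Lemma haar_contentU_disj C D : hausdorff_space G -> compact C -> compact D ->
  C `&` D = set0 ->
  haar_content C + haar_content D <= haar_content (C `|` D).
Proof.
move=> hG cC cD CD; rewrite /haar_content -limD; [|exact: covratio_cvg..].
apply: ler_lim_filter.
- by apply: is_cvgD; exact: covratio_cvg.
- exact/covratio_cvg/compactU.
have oD : open (~` D) by apply: closed_openC; exact: compact_closed.
have [] := @compact_uniform_cover G C (fun=> ~` D) cC (fun=> oD).
  by move=> x Cx; exists 0%N => // Dx; have : (C `&` D) x by []; rewrite CD.
move=> [S W] /= [[n0 _ nS] W1] SW.
have CW : \forall V \near powerset_filter_from (nbhs (1%g : G)),
    forall x v, C x -> V v -> ~ D (x * v)%g.
  apply: filterS W1 => V WV x v Cx Vv.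
  by have [_ _] := SW (n0, V) (conj (nS n0 (leqnn n0)) WV) x Cx; exact.
have [|V0 V01 V0D] := (near_powerset_filter_fromP _ _).1 CW.
  by move=> A B AB BD x v Cx /AB; exact: BD.
(* If [V] lies in both [A^-1] and [B], then [v^-1 w] is in [V0] for all [v] and [w] in [V]. *)
have [] := @nbhs_mulg G 1%g 1%g V0; first by rewrite mulg1.
move=> A [B [nA nB AB]].
have nA' : nbhs (1%g : G) [set x | A (x^-1)%g].
  by apply: (@invg_continuous G 1%g); rewrite invg1.
have VAB : \forall V \near U, V `<=` [set x | A (x^-1)%g] `&` B.
  by apply: U1; apply: small_set_sub; exact: filterI.
apply: filterS (filterI U_nbhs VAB) => V [V1 {}VAB] /=.
rewrite -mulrDl ler_wpM2r// -natrD ler_nat.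
have [s sCD] := compact_covers (compactU cC cD) V1.
apply: covnumU_ge sCD _ => a v w Ca Vv Vw; apply: V0D => //.
by apply: AB; [have [] := VAB _ Vv|have [] := VAB _ Vw].
Qed.

Let covnum_translateE C V g : compact C -> nbhs 1%g V ->
  covnum [set x | C (g^-1 * x)%g] V = covnum C V.
Proof.
move=> cC V1; have [s sC] := compact_covers cC V1.
apply/eqP; rewrite eqn_leq (covnum_translate _ sC) /=.
have := covnum_translate (g^-1)%g (covers_translate (g := g) sC).
by congr (covnum _ V <= _)%N; apply/seteqP; split=> x /=; rewrite invgK mulKg.
Qed.

Lemma haar_content_translate C g : compact C ->
  haar_content [set x | C (g^-1 * x)%g] = haar_content C.
Proof.
move=> cC; have cvC := covratio_cvg cC; apply: cvg_lim => //.
rewrite -[haar_content C]addr0.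
apply: cvg_trans (cvgD cvC (cvg_cst 0)); apply: near_eq_cvg.
apply: filterS U_nbhs => V V1 /=; rewrite addr0.
by rewrite /covratio covnum_translateE.
Qed.

Lemma haar_content_unit : haar_content A0 = 1.
Proof.
apply: cvg_lim => //; apply: cvg_near_cst.
apply: filterS covA0_gt0 => V V1.
by rewrite /covratio divff// gt_eqF.
Qed.

Lemma haar_content0 : haar_content set0 = 0.
Proof.
apply: cvg_lim => //; apply: cvg_near_cst.
apply: filterS covA0_gt0 => V V1.
have : (covnum set0 V <= @size G [::])%N by apply: covnum_le.
by rewrite leqn0 => /eqP; rewrite /covratio => ->; rewrite mul0r.
Qed.

Definition haar_inner (O : set G) : \bar R :=
  ereal_sup [set (haar_content C)%:E | C in [set C | compact C /\ C `<=` O]].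

Definition haar_outer (A : set G) : \bar R :=
  ereal_inf [set haar_inner O | O in [set O | open O /\ A `<=` O]].

Local Open Scope ereal_scope.

Lemma haar_inner_ge C O : compact C -> C `<=` O ->
  (haar_content C)%:E <= haar_inner O.
Proof. by move=> cC CO; apply: ereal_sup_ubound; exists C. Qed.

Lemma haar_inner_ge0 O : 0 <= haar_inner O.
Proof.
rewrite -[0]/(0%R%:E) -haar_content0.
by apply: haar_inner_ge => //; exact: compact0.
Qed.

Lemma haar_outer_le A O : open O -> A `<=` O -> haar_outer A <= haar_inner O.
Proof. by move=> oO AO; apply: ereal_inf_lbound; exists O. Qed.

Lemma haar_outer_ge0 A : 0 <= haar_outer A.
Proof. by apply: le_ereal_inf_tmp => _ [ O _ <-]; exact: haar_inner_ge0. Qed.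

Lemma haar_inner0 : haar_inner set0 = 0.
Proof.
apply/eqP; rewrite eq_le haar_inner_ge0 andbT.
apply: ge_ereal_sup => _ [C [_ C0] <-].
by move: C0; rewrite subset0 => ->; rewrite haar_content0.
Qed.

Lemma haar_outer0 : haar_outer set0 = 0.
Proof.
apply/eqP; rewrite eq_le haar_outer_ge0 andbT -haar_inner0.
by apply: haar_outer_le => //; exact: open0.
Qed.

Lemma haar_outerS : {homo haar_outer : A B / A `<=` B >-> A <= B}.
Proof.
move=> A B AB; apply: le_ereal_inf_tmp => _ [ O [oO BO] <-].
by apply: haar_outer_le => //; exact: subset_trans BO.
Qed.

(** A compact subset of the union is covered by finitely many [O i] and can be cut into compact
    pieces, one inside each. *)
Lemma haar_inner_bigcup (O : nat -> set G) : (forall n, open (O n)) ->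
  haar_inner (\bigcup_n O n) <= \sum_(n <oo) haar_inner (O n).
Proof.
move=> oO; apply: ge_ereal_sup => _ [C [cC CO] <-].
have [[S W] /= [[n _ nS] W1]] := compact_uniform_cover cC oO CO.
move=> SW; have [V [V1 VW]] : exists V, nbhs (1%g : G) V /\ W V.
  have /filter_ex[V []] : \forall V \near powerset_filter_from (nbhs (1%g : G)),
    nbhs (1%g : G) V /\ W V by apply: filterI => //; exact: near_small_set.
  by exists V.
(* The closure makes [D i] compact. It stays inside [O i]: near a point [x] of the closure there is
   a [y] with [y V] inside [O i] and [y^-1 x] in [V]. *)
pose D i := C `&` closure [set x | forall v, V v -> O i (x * v)%g].
have cD i : compact (D i) by apply: compact_closedI => //; exact: closed_closure.
have DO i : D i `<=` O i.
  move=> x [_ /(_ _ (nbhs_divgl x V1))[y [yO Vy]]].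
  by have := yO _ Vy; rewrite mulVKg.
have CD : C `<=` \big[setU/set0]_(i < n) D i.
  move=> x Cx; have [i /= ni iO] := SW (n, V) (conj (nS n (leqnn n)) VW) x Cx.
  rewrite -bigcup_mkord; exists i => //; split => //; exact: subset_closure.
apply: (@le_trans _ _ (haar_content (\big[setU/set0]_(i < n) D i))%:E).
  by rewrite lee_fin haar_contentS//; exact: bigsetU_compact.
apply: (@le_trans _ _ (\sum_(0 <= i < n) haar_inner (O i))); last first.
  by apply: nneseries_lim_ge => i _ _; exact: haar_inner_ge0.
rewrite big_mkord; elim: n {SW nS CD} => [|n IH].
  by rewrite !big_ord0 haar_content0.
rewrite !big_ord_recr /=; apply: (@le_trans _ _
  ((haar_content (\big[setU/set0]_(i < n) D i))%:E + (haar_content (D n))%:E)).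
  by rewrite -EFinD lee_fin haar_contentU//; exact: bigsetU_compact.
by apply: leeD => //; exact: haar_inner_ge.
Qed.

Lemma haar_outer_sigma_subadditive : sigma_subadditive haar_outer.
Proof.
move=> A; have [[i ioo]|] := pselect (exists i, haar_outer (A i) = +oo).
  rewrite (eseries_pinfty _ _ ioo) ?leey// => n _.
  by rewrite -ltNye (lt_le_trans _ (haar_outer_ge0 _)).
rewrite -forallNE => Aoo; apply/lee_addgt0Pr => e e0.
rewrite (le_trans _ (epsilon_trick _ _ (ltW e0)))//; last first.
  by move=> n; exact: haar_outer_ge0.
have /choice[ O AO] n : exists O, [/\ open O, A n `<=` O &
    haar_inner O <= haar_outer (A n) + (e / (2 ^ n.+1)%:R)%:E].
  have en1 : (0 < e / (2 ^ n.+1)%:R)%R by rewrite divr_gt0.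
  have fA : haar_outer (A n) \is a fin_num.
    by rewrite ge0_fin_numE ?haar_outer_ge0// ltey; apply/eqP/Aoo.
  have [_ [ O [oO AO] <-] lt] := lb_ereal_inf_adherent en1 fA.
  by exists O; split => //; exact: ltW.
apply: (@le_trans _ _ (haar_inner (\bigcup_n O n))).
  apply: haar_outer_le.
    by apply: bigcup_open => i _; have [] := AO i.
  by apply: subset_bigcup => i _; have [] := AO i.
apply: le_trans (haar_inner_bigcup _) _; first by move=> i; have [] := AO i.
apply: lee_nneseries => i _; first by move=> _; exact: haar_inner_ge0.
by have [] := AO i.
Qed.

Definition haar_outer_measure : {outer_measure set G -> \bar R} :=
  HB.pack haar_outer (isOuterMeasure.Build R G haar_outer haar_outer0
    haar_outer_ge0 haar_outerS haar_outer_sigma_subadditive).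

(** For an open [W] containing [T], a compact [C] in the intersection of [W] and [O] is disjoint
    from any compact [D] in the open set [W \ C], so their contents add up to at most
    [haar_inner W]. Take the supremum over [D], then over [C]. *)
Lemma haar_outer_open_measurable (O : set G) : hausdorff_space G -> open O ->
  haar_outer_measure.-caratheodory O.
Proof.
move=> hG oO; apply: le_caratheodory_measurable => T /=.
apply: le_ereal_inf_tmp => _ [W [oW TW] <-].
have key C : compact C -> C `<=` W `&` O ->
    (haar_content C)%:E + haar_outer (T `&` ~` O) <= haar_inner W.
  move=> cC CWO; apply: (@le_trans _ _ ((haar_content C)%:E + haar_inner (W `\` C))).
    rewrite leeD2lE//; apply: haar_outer_le.
      rewrite setDE; apply: openI => //.
      by apply: closed_openC; exact: compact_closed.
    by move=> x [Tx Ox]; split; [exact: TW|move=> /CWO[]].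
  rewrite addeC -leeBrDr//; apply: ge_ereal_sup => _ [D [cD DWC] <-].
  rewrite leeBrDr// addeC -EFinD; apply: (@le_trans _ _ (haar_content (C `|` D))%:E).
    rewrite lee_fin haar_contentU_disj//.
    by apply/seteqP; split => x // [Cx /DWC[]].
  apply: haar_inner_ge; first exact: compactU.
  by move=> x [/CWO[]//|/DWC[]].
(* Moving this term across the inequality requires it to be finite; if it is infinite, [key] with an
   empty [C] already makes [haar_inner W] infinite. *)
have [Too|Toofin] := eqVneq (haar_outer (T `&` ~` O)) +oo.
  have := key set0 compact0 (@sub0set _ _).
  by rewrite Too addeC haar_content0 adde0 leye_eq => /eqP ->; rewrite leey.
have fT : haar_outer (T `&` ~` O) \is a fin_num.
  by rewrite ge0_fin_numE ?haar_outer_ge0// ltey.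
apply: (@le_trans _ _ (haar_inner (W `&` O) + haar_outer (T `&` ~` O))).
  rewrite leeD2rE//; apply: haar_outer_le; first exact: openI.
  by move=> x [/TW].
rewrite -leeBrDr//; apply: ge_ereal_sup => _ [C [cC CWO] <-].
by rewrite leeBrDr//; exact: key.
Qed.

Lemma haar_outer_translate (A : set G) g :
  haar_outer [set x | A (g^-1 * x)%g] <= haar_outer A.
Proof.
apply: le_ereal_inf_tmp => _ [ O [oO AO] <-].
apply: (@le_trans _ _ (haar_inner [set x | O (g^-1 * x)%g])).
  apply: haar_outer_le; last by move=> x /AO.
  by apply: (@open_comp _ _ (fun x => g^-1 * x)%g) => // x _; exact: mulgl_continuous.
apply: ge_ereal_sup => _ [C [cC CO] <-].
have -> : C = [set x | [set x | C (g * x)%g] (g^-1 * x)%g].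
  by apply/seteqP; split => x /=; rewrite mulVKg.
have cC' : compact [set x | C (g * x)%g].
  have -> : [set x | C (g * x)%g] = (fun x => g^-1 * x)%g @` C.
    apply/seteqP; split => x /=; first by move=> Cx; exists (g * x)%g => //; rewrite mulKg.
    by move=> [y Cy <-]; rewrite mulVKg.
  apply: continuous_compact => //; apply: continuous_subspaceT.
  exact: mulgl_continuous.
rewrite haar_content_translate//; apply: haar_inner_ge => // x /CO /=.
by rewrite mulKg.
Qed.

Lemma haar_outer_unit : 1 <= haar_outer A0.
Proof.
apply: le_ereal_inf_tmp => _ [ O [oO AO] <-].
by rewrite -[1]/(1%R%:E) -haar_content_unit haar_inner_ge.
Qed.

(** Compact subsets of the interior have at most the content of [C]. With local compactness this
    gives sigma-finiteness. *)
Lemma haar_outer_interior C : compact C -> haar_outer C° < +oo.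
Proof.
move=> cC; apply: (@le_lt_trans _ _ (haar_content C)%:E); last exact: ltry.
apply: le_trans (haar_outer_le (@open_interior _ C) (@subset_refl _ _)) _.
apply: ge_ereal_sup => _ [D [cD DC] <-]; rewrite lee_fin haar_contentS//.
exact: subset_trans (@interior_subset _ _).
Qed.

End HaarContent.

Lemma second_countable_seq (T : topologicalType) : @second_countable T ->
  exists2 f : nat -> set T, (forall n, open (f n)) &
    forall x A, nbhs x A -> exists2 n, f n x & f n `<=` A.
Proof.
move=> [B /countable_injP[i injB] [Bo Bb]].
(* The fibre of the injection [i] over [n] has at most one element, so each union is a basic open
   set or empty. *)
exists (fun n => \bigcup_(V in [set V | B V /\ i V = n]) V).
  by move=> n; apply: bigcup_open => V [/Bo].
move=> x A /Bb[V [BV Vx] VA]; exists (i V); first by exists V.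
move=> y [W [BW iWV] Wy]; apply: VA.
by rewrite (_ : V = W)//; apply: injB; rewrite ?inE.
Qed.

(** Fubini only compares null sets, hence the form given to left invariance. *)
Theorem haar_measure_exists (R : realType) (G : topologicalGroupType) :
  locally_compact [set: G] -> @second_countable G -> hausdorff_space G ->
  exists mu : {measure set (borel (pgroup G)) -> \bar R},
    [/\ sigma_finite setT mu, mu setT <> 0%E &
        forall g A, mu A = 0%E -> mu [set x | A (g^-1 * x)%g] = 0%E].
Proof.
move=> lcG /second_countable_seq[f fo fb] hG.
have cnbhs (x : G) : exists2 C, nbhs x C & compact C.
  by have [C + [cC _]] := lcG x I; rewrite withinET; exists C.
have [A0 A01 A0c] := cnbhs 1%g.
have [U [UU U1]] :=
  ultraFilterLemma (@powerset_filter_from_filter _ _ (nbhs_pfilter (1%g : G))).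
pose m : {outer_measure set (pgroup G) -> \bar R} :=
  haar_outer_measure A0c A01 UU U1.
have mo (O : set G) : open O -> m.-caratheodory O.
  exact: haar_outer_open_measurable.
have mC : (@measurable _ (borel (pgroup G))) `<=` m.-caratheodory.
  apply: smallest_sub => //.
  exact: (@sigma_algebra_measurable _ (caratheodory_type m)).
have m_additive : semi_sigma_additive (m : set (borel (pgroup G)) -> \bar R).
  move=> F mF tF mUF; apply: (@caratheodory_measure_sigma_additive _ _ m) => //.
  - by move=> i; exact: (mC _ (mF i)).
  - exact: mC.
pose mu : {measure set (borel (pgroup G)) -> \bar R} :=
  HB.pack (m : set (borel (pgroup G)) -> \bar R)
    (isMeasure.Build _ (borel (pgroup G)) R m (outer_measure0 m)
      (outer_measure_ge0 m) m_additive).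
exists mu; split.
(* The basic open sets contained in some compact set cover [G], and each lies in the interior of
   that compact set. *)
- exists (fun n =>
    if `[< exists2 C : set G, compact C & f n `<=` C >] then f n else set0).
    apply/seteqP; split => // x _; have [C xC cC] := cnbhs x.
    have [n fnx fnC] := fb x C xC; exists n => //; case: asboolP => // -[].
    by exists C.
  move=> n; case: asboolP => [[C cC fC]|_]; last by split; rewrite ?measure0.
  split; first exact: sub_sigma_algebra.
  have := haar_outer_interior (R:=R) A0c A01 UU U1 cC; apply: le_lt_trans.
  by apply: haar_outerS => //; rewrite -open_subsetE.
- apply/eqP; rewrite gt_eqF//; apply: (@lt_le_trans _ _ 1%E) => //.
  apply: le_trans (haar_outer_unit (R:=R) A0c A01 UU U1) _.
  exact: haar_outerS.
- move=> g A A0'; apply/eqP; rewrite eq_le measure_ge0 andbT -A0'.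
  exact: haar_outer_translate.
Qed.

(** * Null sets of quasi-invariant measures *)

Section SigmaFiniteMeasure.
Context {d} {T : measurableType d} {R : realType}.
Variables (mu : {measure set T -> \bar R}) (mu_sfin : sigma_finite setT mu).

(** The proof of sigma-finiteness is an argument of the alias, from which instance inference
    recovers it. *)
Definition sfin_measure of sigma_finite setT mu : set T -> \bar R := mu.

HB.instance Definition _ := Measure.copy (sfin_measure mu_sfin) mu.
HB.instance Definition _ :=
  Measure_isSigmaFinite.Build d T R (sfin_measure mu_sfin) mu_sfin.

End SigmaFiniteMeasure.

Section NullSections.
Context {d1 d2} {T1 : measurableType d1} {T2 : measurableType d2} {R : realType}.
Variables (m1 : {sigma_finite_measure set T1 -> \bar R}).
Variables (m2 : {sigma_finite_measure set T2 -> \bar R}).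
Variables (A : set (T1 * T2)) (mA : measurable A).
Local Open Scope ereal_scope.

Lemma product_measure_null_xsection :
  (m1 \x m2) A = 0 <-> {ae m1, forall x, m2 [set y | A (x, y)] = 0}.
Proof.
rewrite /product_measure1.
have := ae_eq_integral_abs m1 measurableT (measurable_fun_xsection m2 mA).
under eq_integral do rewrite /= gee0_abs//.
move=> ->; split; apply: filterS => x.
  by move=> /(_ I) /=; rewrite xsectionE.
by move=> + _ /=; rewrite xsectionE.
Qed.

(** The exchange of the order of integration comes from the uniqueness of the product measure: both
    iterated integrals agree on rectangles. *)
Lemma product_measure_null_ysection :
  (m1 \x m2) A = 0 <-> {ae m2, forall y, m1 [set x | A (x, y)] = 0}.
Proof.
rewrite (@product_measure_unique _ _ _ _ _ m1 m2 (m1 \x^ m2))//; last first.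
  by move=> X Y mX mY; exact: product_measure2E.
rewrite /= /product_measure2.
have := ae_eq_integral_abs m2 measurableT (measurable_fun_ysection m1 mA).
under eq_integral do rewrite /= gee0_abs//.
move=> ->; split; apply: filterS => x.
  by move=> /(_ I) /=; rewrite ysectionE.
by move=> + _ /=; rewrite ysectionE.
Qed.

End NullSections.

(** By second countability an open subset of [X * Y] is a countable union of open rectangles, hence
    belongs to the product of the Borel sigma-algebras. *)
Lemma continuous_borel_measurable2 (X Y Z : ptopologicalType)
    (f : X * Y -> Z) (W : set (borel Z)) :
  @second_countable X -> @second_countable Y -> continuous f ->
  measurable W -> measurable (f @^-1` W : set (borel X * borel Y)).
Proof.
move=> /second_countable_seq[u uo ub] /second_countable_seq[v vo vb] cf mW.
have mf : measurable_fun setT (f : borel X * borel Y -> borel Z).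
  apply: (@measurability _ _ (borel X * borel Y)%type (borel Z) setT f (@open Z)).
    by [].
  move=> _ [V oV <-].
  rewrite setTI.
  pose N := [set n : nat * nat | u n.1 `*` v n.2 `<=` f @^-1` V].
  have -> : f @^-1` V = \bigcup_(n in N) (u n.1 `*` v n.2).
    apply/seteqP; split => [[x y] Vxy|p [n Nn]]; last exact: Nn.
    have [[A B] /= [nA nB] AB] : nbhs (x, y) (f @^-1` V).
      by apply: cf; exact: open_nbhs_nbhs.
    have [i uix uA] := ub x A nA; have [j vjy vB] := vb y B nB.
    exists (i, j) => //= -[a b] [/= /uA Aa /vB Bb]; exact: (AB (a, b)).
  rewrite bigcup_mkcond; apply: countable_bigcupT_measurable => // n.
  case: ifPn => // _; apply: measurableX.
    by apply: sub_sigma_algebra.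
  by apply: sub_sigma_algebra.
by rewrite -[X in measurable X]setTI; exact: mf.
Qed.

Section QuasiInvariantNull.
Context {R : realType} {G : topologicalGroupType} {S : ptopologicalType}.
Variables (act : G -> S -> S).
Hypotheses (Gsc : @second_countable G) (Ssc : @second_countable S).
Hypotheses (act_cont : continuous_action act) (act_trans : transitive_action act).
Variables (h : {measure set (borel (pgroup G)) -> \bar R}).
Hypotheses (h_sfin : sigma_finite setT h).
Hypothesis h_inv : forall g A, h A = 0%E -> h [set x | A (g^-1 * x)%g] = 0%E.

(* For [mu]-almost every [s], hence by transitivity and left invariance for
   every [s], the set of the [g] with [g^-1 s] in [X] is Haar null. *)
Lemma null_translates_ae (mu nu : {measure set (borel S) -> \bar R})
    (X : set (borel S)) :
  sigma_finite setT mu -> mu setT <> 0%E -> sigma_finite setT nu ->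
  measurable X -> (forall g, mu [set s | X (act g^-1%g s)] = 0%E) ->
  {ae h, forall g, nu [set s | X (act (g : G)^-1%g s)] = 0%E}.
Proof.
move=> mu_sfin mu0 nu_sfin mX muX; have [act1 actM actC] := act_cont.
pose h' := [the {sigma_finite_measure set (borel (pgroup G)) -> \bar R}
  of sfin_measure h_sfin].
pose mu' := [the {sigma_finite_measure set (borel S) -> \bar R}
  of sfin_measure mu_sfin].
pose nu' := [the {sigma_finite_measure set (borel S) -> \bar R}
  of sfin_measure nu_sfin].
pose A := [set p : borel (pgroup G) * borel S | X (act (p.1 : G)^-1%g p.2)].
have mA : measurable A.
  apply: (@continuous_borel_measurable2 (pgroup G) S S
    (fun p : G * S => act p.1^-1%g p.2)) => // p.
  apply: (@continuous_comp _ _ _ (fun p : G * S => (p.1^-1%g, p.2))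
    (fun p : G * S => act p.1 p.2)); last exact: actC.
  apply: cvg_pair; last exact: cvg_snd.
  apply: (cvg_comp _ _ (@cvg_fst _ _ _ _ _)); exact: invg_continuous.
have : {ae h', forall g, mu' [set s | A (g, s)] = 0%E}.
  by apply: filterE => g; exact: muX.
move=> /(product_measure_null_xsection h' mu' mA).
move=> /(product_measure_null_ysection h' mu' mA) ae_s.
(* As [mu] is not zero, a property true almost everywhere is true somewhere. *)
have [s hs] : exists s, h [set g | A (g, s)] = 0%E.
  apply: contrapT => /forallNP hs; apply: mu0.
  have : mu.-negligible setT.
    have -> : setT = ~` [set s | h' [set g | A (g, s)] = 0%E].
      by apply/seteqP; split => // s _ /hs.
    exact: ae_s.
  by move=> /negligibleP; exact.
(* For [t = k s], the identity [g^-1 (k s) = (k^-1 g)^-1 s] exhibits the set for [t] as the left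
   translate by [k] of the set for [s]. *)
have h_all t : h [set g | A (g, t)] = 0%E.
  have [k <-] := act_trans s t.
  rewrite -(h_inv k hs); congr (h _); apply/seteqP.
  by split=> g; rewrite /A /= invgM invgK actM.
apply/(product_measure_null_xsection h' nu' mA).
apply/(product_measure_null_ysection h' nu' mA).
by apply: filterE => t; exact: h_all.
Qed.

End QuasiInvariantNull.

(** * Hilbert space geometry *)

Section LinearFunctions.
Context {K : numFieldType} {V W : normedModType K} (A : V -> W).
Hypothesis linA : linear A.

Lemma linear_fun0 : A 0 = 0.
Proof.
by apply: (addrI (A 0)); rewrite addr0; have := linA 1 0 0; rewrite !scale1r addr0.
Qed.

Lemma linear_funD x y : A (x + y) = A x + A y.
Proof. by have := linA 1 x y; rewrite !scale1r. Qed.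

Lemma linear_funZ a x : A (a *: x) = a *: A x.
Proof. by have := linA a x 0; rewrite linear_fun0 !addr0. Qed.

Lemma linear_funN x : A (- x) = - A x.
Proof. by rewrite -scaleN1r linear_funZ scaleN1r. Qed.

Lemma linear_funB x y : A (x - y) = A x - A y.
Proof. by rewrite linear_funD linear_funN. Qed.

Lemma linear_fun_sum (I : Type) (s : seq I) (P : pred I) (f : I -> V) :
  A (\sum_(i <- s | P i) f i) = \sum_(i <- s | P i) A (f i).
Proof. by apply: big_morph; [exact: linear_funD | exact: linear_fun0]. Qed.

End LinearFunctions.

Section RealNorm.
Context {R : realType}.

(** The norm of a space over [R[i]] takes its values in [R[i]]; the real part gives access to the
    order and the limits of [R]. *)
Definition rnorm {V : normedModType R[i]} (x : V) : R := complex.Re `|x|.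

Section RnormTheory.
Context {V : normedModType R[i]}.
Implicit Types (x y : V).

Lemma rnormE x : (rnorm x)%:C = `|x|.
Proof. by rewrite /rnorm RRe_real// ger0_real. Qed.

Lemma rnorm_ge0 x : 0 <= rnorm x.
Proof. by rewrite -ler0c rnormE. Qed.

Lemma rnorm0 : rnorm (0 : V) = 0.
Proof. by rewrite /rnorm normr0. Qed.

Lemma rnormN x : rnorm (- x) = rnorm x.
Proof. by rewrite /rnorm normrN. Qed.

Lemma rnormD x y : rnorm (x + y) <= rnorm x + rnorm y.
Proof. by rewrite -lecR rmorphD/= !rnormE ler_normD. Qed.

Lemma rnormZ a x : rnorm (a *: x) = rnorm a * rnorm x.
Proof. by apply: complexI; rewrite rmorphM /= !rnormE normrZ. Qed.

Lemma rnorm_eq0 x : (rnorm x == 0) = (x == 0).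
Proof. by rewrite -(inj_eq (@complexI R)) rnormE normr_eq0. Qed.

Lemma rnorm_sum (I : Type) (s : seq I) (P : pred I) (f : I -> V) :
  rnorm (\sum_(i <- s | P i) f i) <= \sum_(i <- s | P i) rnorm (f i).
Proof.
elim/big_ind2 : _ => [|x a y b xa yb|//]; first by rewrite rnorm0.
by rewrite (le_trans (rnormD _ _))// lerD.
Qed.

Lemma cvg_rnormP {T : Type} {F : set_system T} {FF : Filter F} (f : T -> V) l :
  f x @[x --> F] --> l <->
  forall e : R, 0 < e -> \forall x \near F, rnorm (l - f x) < e.
Proof.
split => [/cvgrPdist_lt fl e e0|fl].
  by have := fl e%:C; rewrite ltcR => /(_ e0); apply: filterS => x; rewrite -rnormE ltcR.
apply/cvgrPdist_lt => e e0; have er : e = (complex.Re e)%:C.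
  by rewrite RRe_real// gtr0_real.
move: e0; rewrite er ltcR => /fl; apply: filterS => x.
by rewrite -rnormE ltcR.
Qed.

End RnormTheory.

Lemma rnormM (a b : R[i]) : rnorm (a * b) = rnorm a * rnorm b.
Proof. exact: rnormZ. Qed.

Lemma rnorm_real (a : R) : rnorm a%:C = `|a|.
Proof. by rewrite /rnorm normc_def /= expr0n addr0 sqrtr_sqr. Qed.

Lemma rnorm_conj (a : R[i]) : rnorm (Num.conj a) = rnorm a.
Proof. by rewrite /rnorm norm_conjC. Qed.

Lemma rnorm_sqr (a : R[i]) : (rnorm a ^+ 2)%:C = a * Num.conj a.
Proof. by rewrite rmorphXn/= rnormE normCK. Qed.

Lemma Re_le_rnorm (a : R[i]) : `|complex.Re a| <= rnorm a.
Proof. by rewrite -lecR rnormE normc_ge_Re. Qed.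

Lemma Im_le_rnorm (a : R[i]) : `|complex.Im a| <= rnorm a.
Proof.
rewrite -(mulr1 (rnorm a)) (_ : 1 = rnorm ('i%C : R[i])); last first.
  by rewrite /rnorm normc_def /= expr0n /= expr1n add0r sqrtr1.
rewrite -rnormM (le_trans _ (Re_le_rnorm _))//.
by rewrite ReiNIm normrN.
Qed.

Lemma rnorm_le_ReIm (a : R[i]) : rnorm a <= `|complex.Re a| + `|complex.Im a|.
Proof.
rewrite {1}(complexE a) (le_trans (rnormD _ _))// rnormM !rnorm_real.
rewrite (_ : rnorm ('i%C : R[i]) = 1) ?mul1r//.
by rewrite /rnorm normc_def /= expr0n /= expr1n add0r sqrtr1.
Qed.

Lemma cvg_complexP {T : Type} {F : set_system T} {FF : Filter F}
    (f : T -> R[i]) (l : R[i]) :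
  f x @[x --> F] --> l <->
  (complex.Re (f x) @[x --> F] --> complex.Re l) /\
  (complex.Im (f x) @[x --> F] --> complex.Im l).
Proof.
split=> [/cvg_rnormP fl|[/cvgrPdist_lt fr /cvgrPdist_lt fi]].
  split; apply/cvgrPdist_lt => e /fl; apply: filterS => x; apply: le_lt_trans.
    by rewrite -raddfB; exact: Re_le_rnorm.
  by rewrite -raddfB; exact: Im_le_rnorm.
apply/cvg_rnormP => e e0; have e20 : 0 < e / 2 by rewrite divr_gt0.
apply: filterS (filterI (fr _ e20) (fi _ e20)) => x [xr xi].
by rewrite (le_lt_trans (rnorm_le_ReIm _))// !raddfB /= (splitr e) ltrD.
Qed.

Lemma bounded_opP {H : hilbertType R} (A : H -> H) : bounded_op A ->
  exists2 M : R, 0 <= M & forall x, rnorm (A x) <= M * rnorm x.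
Proof.
move=> [linA cA].
have /cvg_rnormP : A y @[y --> (0 : H)] --> A 0 by exact: cA.
move=> /(_ 1 ltr01) /nbhs_norm0P[e e0 Ae]; rewrite linear_fun0// in Ae.
have er : e = (complex.Re e)%:C by rewrite RRe_real// gtr0_real.
set d := complex.Re e in er; have d0 : 0 < d by rewrite -ltcR -er.
exists (2 / d); first by rewrite divr_ge0// ltW.
move=> x; have [->|x0] := eqVneq x 0.
  by rewrite linear_fun0// !rnorm0 mulr0.
have nx0 : 0 < rnorm x by rewrite lt_neqAle rnorm_ge0 eq_sym rnorm_eq0 x0.
(* [c] rescales [x] to norm [d / 2], inside the ball where [A] has norm below [1]. *)
pose c : R := d / 2 / rnorm x; have c0 : 0 < c by rewrite !divr_gt0.
have := Ae (c%:C *: x); rewrite /= (linear_funZ linA) sub0r rnormN.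
rewrite -rnormE er ltcR !rnormZ !rnorm_real !gtr0_norm// => Hx.
have {Hx} : c * rnorm (A x) < 1.
  by apply: Hx; rewrite /c divfK ?gt_eqF// ltr_pdivrMr// mulr_natr mulr2n ltrDl.
rewrite -ltr_pdivlMl// mulr1 => /ltW /le_trans; apply.
by rewrite /c !invfM !invrK [d^-1 * _]mulrC.
Qed.

End RealNorm.

Section InnerProduct.
Context {R : realType} {H : hilbertType R}.
Implicit Types (x y z : H) (a : R[i]).

Lemma innerC x y : '[y, x] = Num.conj '[x, y].
Proof. by have := hermC (@inner R H) y x; rewrite expr0 mul1r. Qed.

Lemma innerDl x y z : '[x + y, z] = '[x, z] + '[y, z].
Proof. by rewrite linearDl. Qed.

Lemma innerZl a x z : '[a *: x, z] = a * '[x, z].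
Proof. by rewrite linearZl_LR. Qed.

Lemma innerDr x y z : '[z, x + y] = '[z, x] + '[z, y].
Proof. by rewrite innerC innerDl rmorphD/= -!innerC. Qed.

Lemma innerZr a x z : '[z, a *: x] = Num.conj a * '[z, x].
Proof. by rewrite innerC innerZl rmorphM/= -!innerC. Qed.

Lemma inner0l x : '[0, x] = 0.
Proof. by rewrite -(scale0r 0) innerZl mul0r. Qed.

Lemma inner0r x : '[x, 0] = 0.
Proof. by rewrite innerC inner0l rmorph0. Qed.

Lemma innerNl x y : '[- x, y] = - '[x, y].
Proof. by rewrite -scaleN1r innerZl mulN1r. Qed.

Lemma innerNr x y : '[y, - x] = - '[y, x].
Proof. by rewrite innerC innerNl rmorphN/= -innerC. Qed.

Lemma innerBl x y z : '[x - y, z] = '[x, z] - '[y, z].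
Proof. by rewrite innerDl innerNl. Qed.

Lemma innerBr x y z : '[z, x - y] = '[z, x] - '[z, y].
Proof. by rewrite innerDr innerNr. Qed.

Lemma inner_suml (I : Type) (s : seq I) (P : pred I) (f : I -> H) y :
  '[\sum_(i <- s | P i) f i, y] = \sum_(i <- s | P i) '[f i, y].
Proof.
apply: (big_morph (fun x => '[x, y])); last exact: inner0l.
by move=> *; exact: innerDl.
Qed.

Lemma inner_sumr (I : Type) (s : seq I) (P : pred I) (f : I -> H) y :
  '[y, \sum_(i <- s | P i) f i] = \sum_(i <- s | P i) '[y, f i].
Proof. by apply: big_morph; [move=> *; exact: innerDr | exact: inner0r]. Qed.

Lemma inner_rnorm x : '[x, x] = (rnorm x ^+ 2)%:C.
Proof. by rewrite innerxx rmorphXn/= rnormE. Qed.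

Section PositiveForm.
Variable P : H -> H.
Hypotheses (linP : linear P) (posP : positive_op P).

Definition qform x : R := complex.Re '[P x, x].

Lemma qformE x : '[P x, x] = (qform x)%:C.
Proof.
by rewrite /qform RRe_real// ger0_real//; have := posP x; rewrite inner0l.
Qed.

Lemma qform_ge0 x : 0 <= qform x.
Proof. by rewrite -ler0c -qformE; have := posP x; rewrite inner0l. Qed.

(** Polarization: reality of the diagonal at [x + y] makes the imaginary parts opposite, and at
    [x + i y] it makes the real parts equal. *)
Lemma positive_op_sym x y : '[P y, x] = Num.conj '[P x, y].
Proof.
have e1 : '[P (x + y), x + y] = '[P x, x] + '[P y, y] + ('[P x, y] + '[P y, x]).
  by rewrite (linear_funD linP) !innerDl !innerDr; ring.
have e2 : '[P (x + 'i%C *: y), x + 'i%C *: y] =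
    '[P x, x] + '[P y, y] + 'i%C * ('[P y, x] - '[P x, y]).
  rewrite (linear_funD linP) (linear_funZ linP) !innerDl !innerDr !innerZl !innerZr.
  have i2 : 'i%C * Num.conj 'i%C = 1 :> R[i].
    by rewrite -normCK normc_def /= expr0n expr1n add0r sqrtr1 expr1n.
  have i3 : Num.conj 'i%C = - 'i%C :> R[i].
    by apply/eqP; rewrite eq_complex /= oppr0 !eqxx.
  rewrite mulrA i2 mul1r i3; ring.
move/(congr1 (@complex.Im R)) : e1; move/(congr1 (@complex.Im R)) : e2.
rewrite !qformE; case: '[P x, y] => a b; case: '[P y, x] => c d /=.
simpc => /= h1 h2.
by apply/eqP; rewrite eq_complex /=; apply/andP; split; apply/eqP; lra.
Qed.

Lemma qformD x y : qform (x + y) = qform x + qform y + 2 * complex.Re '[P x, y].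
Proof.
rewrite /qform (linear_funD linP) !innerDl !innerDr (positive_op_sym x y).
by rewrite !raddfD /=; case: '[P x, y] => a b /=; ring.
Qed.

Lemma qformZ a x : qform (a *: x) = rnorm a ^+ 2 * qform x.
Proof.
apply: complexI; rewrite -qformE rmorphM /= -qformE rnorm_sqr.
by rewrite (linear_funZ linP) innerZl innerZr mulrA.
Qed.

Lemma qform_CauchySchwarz x y : rnorm '[P x, y] ^+ 2 <= qform x * qform y.
Proof.
set f := '[P x, y].
have key (t : R) : 0 <= qform x - 2 * t * rnorm f ^+ 2 + t ^+ 2 * rnorm f ^+ 2 * qform y.
  have := qform_ge0 (x + (- t%:C * f) *: y).
  rewrite qformD qformZ rnormM rnormN rnorm_real innerZr -/f exprMn real_normK ?num_real//.
  suff -> : complex.Re (Num.conj (- t%:C * f) * f) = - t * rnorm f ^+ 2.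
    by move=> h; apply: le_trans h _; rewrite le_eqVlt; apply/orP; left; apply/eqP; ring.
  rewrite rmorphM rmorphN /= -mulrA [_ * f]mulrC -rnorm_sqr.
  have -> : Num.conj t%:C = t%:C by exact: conjc_real.
  by rewrite -rmorphN -rmorphM.
have [y0|y0] := eqVneq (qform y) 0.
  rewrite y0 mulr0; have [//|f0] := leP (rnorm f ^+ 2) 0.
  (* For a null vector [y] the bound is affine in [t], and this [t] gives it the value [-1]. *)
  have := key ((qform x + 1) / (2 * rnorm f ^+ 2)).
  rewrite y0 mulr0 addr0 (_ : 2 * _ * _ = qform x + 1); first lra.
  have fn0 : rnorm f != 0 by apply: contraTneq f0 => ->; rewrite expr0n ltxx.
  by field.
have qy : 0 < qform y by rewrite lt_neqAle eq_sym y0 qform_ge0.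
(* The quadratic bound attains its minimum at this [t]. *)
have := key (qform y)^-1.
rewrite (_ : _ + _ = qform x - rnorm f ^+ 2 / qform y).
  by rewrite subr_ge0 ler_pdivrMr.
by field.
Qed.

End PositiveForm.

Lemma CauchySchwarz_inner x y : rnorm '[x, y] <= rnorm x * rnorm y.
Proof.
have pos : positive_op (fun x : H => x).
  by move=> z; rewrite inner0l inner_rnorm ler0c sqr_ge0.
have := qform_CauchySchwarz (fun _ _ _ => erefl) pos x y.
rewrite /qform !inner_rnorm /= -exprMn ler_sqr// nnegrE ?mulr_ge0 ?rnorm_ge0//.
Qed.

Lemma cvg_innerl {T : Type} {F : set_system T} {FF : Filter F} (u : T -> H) x y :
  u t @[t --> F] --> x -> '[u t, y] @[t --> F] --> '[x, y].
Proof.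
move=> /cvg_rnormP ux; apply/cvg_rnormP => e e0.
have y1 : 0 < rnorm y + 1 by rewrite ltr_wpDl// rnorm_ge0.
have ey : 0 < e / (rnorm y + 1) by rewrite divr_gt0.
apply: filterS (ux _ ey) => t; rewrite ltr_pdivlMr// => h.
rewrite -innerBl (le_lt_trans (CauchySchwarz_inner _ _))// (le_lt_trans _ h)//.
by rewrite ler_wpM2l ?rnorm_ge0// lerDl.
Qed.

Lemma cvg_innerr {T : Type} {F : set_system T} {FF : Filter F} (u : T -> H) x y :
  u t @[t --> F] --> x -> '[y, u t] @[t --> F] --> '[y, x].
Proof.
move=> /(cvg_innerl (y := y)) /cvg_rnormP ux; apply/cvg_rnormP => e /ux.
apply: filterS => t; rewrite (innerC x y) (innerC (u t) y) -rmorphB/=.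
by rewrite rnorm_conj.
Qed.

End InnerProduct.

Lemma conjMN_real {R : realType} (c : R[i]) (a : R) :
  Num.conj (- (c / a%:C)) * c = (- (rnorm c ^+ 2 / a))%:C.
Proof.
have conja : Num.conj a%:C = a%:C by exact: conjc_real.
rewrite rmorphN rmorphM fmorphV /= conja mulNr mulrAC.
have := rnorm_sqr c; rewrite mulrC => <-.
by rewrite -fmorphV -rmorphM -rmorphN.
Qed.

(** * Gram-Schmidt for a possibly degenerate positive form *)

Section GramSchmidt.
Context {R : realType} {H : hilbertType R}.
Variables (P : H -> H) (M : R) (e : nat -> H).
Hypotheses (linP : linear P) (posP : positive_op P).
Hypotheses (M0 : 0 <= M) (PM : forall x, rnorm (P x) <= M * rnorm x).
Local Notation q := (qform P).

Lemma qform_eq0_inner x y : q y = 0 -> '[P x, y] = 0.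
Proof.
move=> y0; apply/eqP; rewrite -rnorm_eq0 -sqrf_eq0 eq_le sqr_ge0 andbT.
by rewrite (le_trans (qform_CauchySchwarz linP posP x y))// y0 mulr0.
Qed.

Lemma qform_le x : q x <= M * rnorm x ^+ 2.
Proof.
rewrite (le_trans (ler_norm _))// (le_trans (Re_le_rnorm _))//.
rewrite (le_trans (CauchySchwarz_inner _ _))// expr2 mulrA.
by rewrite ler_wpM2r ?rnorm_ge0.
Qed.

(** Cauchy-Schwarz for the form at [x] and [P x], divided by the square norm of [P x]. It turns
    smallness of the form into smallness of [P x]. *)
Lemma positive_op_rnorm_le x : rnorm (P x) ^+ 2 <= M * q x.
Proof.
have [->|Px0] := eqVneq (rnorm (P x)) 0.
  by rewrite expr0n mulr_ge0// qform_ge0.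
have Px : 0 < rnorm (P x) ^+ 2 by rewrite exprn_gt0// lt_neqAle eq_sym Px0 rnorm_ge0.
have := qform_CauchySchwarz linP posP x (P x).
rewrite inner_rnorm rnorm_real (ger0_norm (sqr_ge0 _)) => h.
rewrite -(ler_pM2r Px) -expr2 (le_trans h)// [M * _]mulrC -mulrA.
by rewrite ler_wpM2l ?qform_ge0// qform_le.
Qed.

(* [gs_res k y] is [y] minus its [P]-orthogonal projection on the span of
   [e 0, .., e (k - 1)]; a division by a vanishing square norm gives [0]. *)
Fixpoint gs_res (k : nat) : H -> H :=
  if k is k'.+1 then
    fun y => gs_res k' y - ('[P (gs_res k' y), gs_res k' (e k')] /
      (q (gs_res k' (e k')))%:C) *: gs_res k' (e k')
  else id.

Local Notation h k := (gs_res k (e k)).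

Lemma gs_res_linear k : linear (gs_res k).
Proof.
elim: k => [//|k IH] a x y /=.
rewrite IH (linear_funD linP) (linear_funZ linP) innerDl innerZl.
rewrite mulrDl scalerDl -mulrA -scalerA.
by rewrite opprD addrACA -scalerBr.
Qed.

Lemma gs_res_orth k j y : (j < k)%N -> '[P (gs_res k y), h j] = 0.
Proof.
elim: k y => [//|k IH] y; rewrite ltnS leq_eqVlt => /orP[/eqP ->|jk] /=.
  rewrite (linear_funB linP) (linear_funZ linP) innerBl innerZl qformE//.
  (* For a null [h k] the subtracted term is zero, but Cauchy-Schwarz already makes the pairing with
     [h k] vanish. *)
  have [a0|a0] := eqVneq (q (h k)) 0.
    by rewrite a0 mulr0 subr0 qform_eq0_inner.
  by rewrite divfK ?subrr// (inj_eq (@complexI R)).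
by rewrite (linear_funB linP) (linear_funZ linP) innerBl innerZl !IH// mulr0 subr0.
Qed.

(** The coefficients can be read off [y] itself: [h k] is [P]-orthogonal to the earlier [h j], so
    subtracting those does not affect the pairing with [h k]. *)
Lemma gs_res_sum k y :
  gs_res k y = y - \sum_(0 <= j < k) ('[P y, h j] / (q (h j))%:C) *: h j.
Proof.
elim: k => [|k IH] /=; first by rewrite big_nil subr0.
rewrite big_nat_recr//= opprD addrA -IH; congr (_ - (_ / _) *: _).
rewrite [in LHS]IH (linear_funB linP) innerBl (linear_fun_sum linP) inner_suml.
rewrite big_nat big1 ?subr0// => j /andP[_ jk].
rewrite (linear_funZ linP) innerZl (positive_op_sym linP posP (h k)).
by rewrite gs_res_orth// rmorph0 mulr0.
Qed.

Lemma qform_gs_resS k y : q (gs_res k.+1 y) =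
  q (gs_res k y) - rnorm '[P (gs_res k y), h k] ^+ 2 / q (h k).
Proof.
rewrite /=; set x := gs_res k y; set z := h k; set c := '[P x, z].
rewrite -scaleNr qformD// qformZ// rnormN innerZr -/c rnormM.
rewrite -fmorphV rnorm_real exprMn real_normK ?num_real// fmorphV conjMN_real /=.
have [->|z0] := eqVneq (q z) 0; first by rewrite invr0; ring.
by field.
Qed.

Lemma qform_gs_res k y : q (gs_res k y) =
  q y - \sum_(0 <= j < k) rnorm '[P y, h j] ^+ 2 / q (h j).
Proof.
elim: k => [|k IH]; first by rewrite big_nil subr0.
rewrite qform_gs_resS IH big_nat_recr//= opprD addrA; congr (_ - rnorm _ ^+ 2 / _).
rewrite gs_res_sum (linear_funB linP) innerBl (linear_fun_sum linP) inner_suml.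
rewrite big_nat big1 ?subr0// => j /andP[_ jk].
rewrite (linear_funZ linP) innerZl (positive_op_sym linP posP (h k)).
by rewrite gs_res_orth// rmorph0 mulr0.
Qed.

Lemma qform_gs_res_le k j y : (j <= k)%N -> q (gs_res k y) <= q (gs_res j y).
Proof.
move=> /subnKC <-; elim: (k - j)%N => [|n IH]; first by rewrite addn0.
rewrite addnS (le_trans _ IH)// qform_gs_resS gerBl.
by rewrite divr_ge0 ?sqr_ge0// qform_ge0.
Qed.

(** Step [j] brings the form of the residual of [e j] to zero and later steps do not increase it;
    [positive_op_rnorm_le] passes from the form to [P]. *)
Lemma P_gs_res_eq0 k j : (j < k)%N -> P (gs_res k (e j)) = 0.
Proof.
move=> jk; apply/eqP; rewrite -rnorm_eq0 -sqrf_eq0 eq_le sqr_ge0 andbT.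
rewrite (le_trans (positive_op_rnorm_le _))// -(mulr0 M) ler_wpM2l//.
rewrite (le_trans (qform_gs_res_le _ jk))// qform_gs_resS qformE//.
rewrite rnorm_real real_normK ?num_real//.
have [->|z0] := eqVneq (q (h j)) 0; first by rewrite expr0n mul0r subr0.
by rewrite expr2 mulfK// subrr.
Qed.

Hypothesis e_total : forall x (eps : R), 0 < eps ->
  exists n c, rnorm (x - \sum_(0 <= k < n) c k *: e k) < eps.

(** Approximate [y] by a combination [s] of the first [n] vectors. From step [n] on, [P] annihilates
    the residual of [s], and that of [y - s] is mapped to norm at most [M |y - s|]. *)
Lemma P_gs_res_cvg y : P (gs_res n y) @[n --> \oo] --> 0.
Proof.
apply/cvg_rnormP => eps eps0.
have M1 : 0 < M + 1 by rewrite ltr_wpDl.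
have [n [c yc]] := e_total y (divr_gt0 eps0 M1).
exists n => // k /= nk; rewrite sub0r rnormN.
set s := \sum_(_ <= _ < _) _ in yc.
have Ps : P (gs_res k s) = 0.
  rewrite (linear_fun_sum (gs_res_linear k)) (linear_fun_sum linP).
  rewrite big_nat big1// => j /andP[_ jn].
  rewrite (linear_funZ (gs_res_linear k)) (linear_funZ linP) P_gs_res_eq0 ?scaler0//.
  exact: leq_trans jn nk.
have -> : P (gs_res k y) = P (gs_res k (y - s)).
  by rewrite (linear_funB (gs_res_linear k)) (linear_funB linP) Ps subr0.
set z := y - s in yc *; apply: (@le_lt_trans _ _ (M * rnorm z)).
  rewrite -(@ler_sqr _ (rnorm _)) ?nnegrE ?mulr_ge0 ?rnorm_ge0//.
  rewrite (le_trans (positive_op_rnorm_le _))// exprMn expr2 -mulrA ler_wpM2l//.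
  by rewrite (le_trans (qform_gs_res_le (j := 0) _ _))//= qform_le.
apply: (@le_lt_trans _ _ ((M + 1) * rnorm z)).
  by rewrite ler_wpM2r ?rnorm_ge0// lerDl.
by rewrite mulrC -ltr_pdivlMr.
Qed.

(** Used with the identity and a dense sequence to produce an orthonormal basis, then with [|T|] and
    a basis to decompose [T]. *)
Theorem gram_schmidt : exists g : nat -> H,
  [/\ forall i j, '[P (g i), g j] = ((i == j) && (q (g i) != 0))%:R,
      forall y n, \sum_(0 <= j < n) rnorm '[y, P (g j)] ^+ 2 <= q y &
      forall y, P (y - \sum_(0 <= j < n) '[y, P (g j)] *: g j)
        @[n --> \oo] --> 0].
Proof.
(* The inverse of [0] being [0], a null [h k] is normalized to the zero vector. *)
pose s k : R := (Num.sqrt (q (h k)))^-1.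
have sE k : s k ^+ 2 = (q (h k))^-1 by rewrite exprVn sqr_sqrtr ?qform_ge0.
have s0 k : 0 <= s k by rewrite invr_ge0 sqrtr_ge0.
pose g k := (s k)%:C *: h k.
have conjs k : Num.conj (s k)%:C = (s k)%:C :> R[i] by exact: conjc_real.
have yg y j : '[y, P (g j)] = (s j)%:C * '[P y, h j].
  by rewrite innerC -(positive_op_sym linP posP) innerZr conjs.
have qg j : q (g j) = s j ^+ 2 * q (h j).
  by rewrite qformZ// rnorm_real real_normK ?num_real.
have q0 j : (q (g j) != 0) = (q (h j) != 0).
  rewrite qg sE; have [->|hj] := eqVneq (q (h j)) 0; first by rewrite mulr0 eqxx.
  by rewrite mulVf ?oner_neq0.
exists g; split.
- move=> i j; rewrite q0; have [->|ij] := eqVneq i j.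
    rewrite qformE// qg sE /=.
    have [->|hj] := eqVneq (q (h j)) 0; first by rewrite mulr0.
    by rewrite mulVf.
  rewrite (linear_funZ linP) innerZl innerZr conjs.
  have [lt_ij|lt_ji|eq_ij] := ltngtP i j; last by rewrite eq_ij eqxx in ij.
    by rewrite (positive_op_sym linP posP (h j)) gs_res_orth// rmorph0 !mulr0.
  by rewrite gs_res_orth// !mulr0.
- move=> y n.
  under eq_bigr do rewrite yg rnormM rnorm_real exprMn real_normK ?num_real// sE mulrC.
  by rewrite -subr_ge0 -qform_gs_res qform_ge0.
- move=> y; apply: cvg_trans (P_gs_res_cvg y); apply: near_eq_cvg.
  apply: nearW => n; rewrite gs_res_sum; congr (P (_ - _)); apply: eq_bigr => j _.
  by rewrite yg /g scalerA mulrAC -rmorphM -expr2 sE fmorphV mulrC.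
Qed.

End GramSchmidt.

Lemma bounded_series_tail {R : realType} (b : nat -> R) (B : R) :
  (forall n, 0 <= b n) -> (forall n, \sum_(0 <= k < n) b k <= B) ->
  forall eps, 0 < eps ->
  exists N, forall m n, (N <= m)%N -> \sum_(m <= k < n) b k < eps.
Proof.
move=> b0 bB eps eps0.
have ndb : nondecreasing_seq (fun n => \sum_(0 <= k < n) b k).
  by apply/nondecreasing_seqP => n; rewrite big_nat_recr//= lerDl.
have ubb : has_ubound (range (fun n => \sum_(0 <= k < n) b k)).
  by exists B => _ [n _ <-].
have := nondecreasing_cvgn ndb ubb; set l := sup _ => /cvgrPdist_lt /(_ eps eps0)[N _ Nl].
exists N => m n Nm; have [nm|mn] := leqP n m; first by rewrite big_geq.
have bn : \sum_(0 <= k < n) b k <= l by apply: ub_le_sup => //; exists n.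
have := Nl m Nm; rewrite /= ger0_norm ?subr_ge0; last by apply: ub_le_sup => //; exists m.
apply: le_lt_trans; rewrite lerBrDl (le_trans _ bn)//.
by rewrite [leRHS](big_cat_nat _ (ltnW mn))//=.
Qed.

(** * Orthonormal expansions and adjoints *)

Section Frames.
Context {R : realType} {H : hilbertType R}.

(* An orthonormal basis indexed by the [k] such that [D k], extended by [0]. *)
Definition frame (D : pred nat) (f : nat -> H) :=
  (forall m n, '[f m, f n] = ((m == n) && D n)%:R) /\
  (forall x, (\sum_(0 <= k < n) '[x, f k] *: f k) @[n --> \oo] --> x).

Lemma orthonormal_basis_frame D e : orthonormal_basis D e ->
  frame D (fun k => if D k then e k else 0).
Proof.
move=> [eD ex]; split => [m n|x].
  case: ifPn => Dm; last first.
    by rewrite inner0l; case: eqVneq => // <-; rewrite (negbTE Dm).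
  case: ifPn => Dn; last by rewrite inner0r andbF.
  by rewrite eD// andbT.
apply: cvg_trans (ex x); apply: near_eq_cvg; apply: nearW => n.
rewrite [LHS]big_mkcond; apply: eq_bigr => k _ /=.
by case: ifP => // _; rewrite scaler0.
Qed.

Section FrameTheory.
Variables (D : pred nat) (f : nat -> H).
Hypothesis fD : frame D f.
Implicit Types (x y : H).

Definition frame_proj n x := \sum_(0 <= k < n) '[x, f k] *: f k.

Lemma frame_proj_cvg x : frame_proj n x @[n --> \oo] --> x.
Proof. exact: fD.2. Qed.

Lemma frame_inner_sum (c : nat -> R[i]) k m n : (m <= k < n)%N ->
  '[\sum_(m <= j < n) c j *: f j, f k] = (D k)%:R * c k.
Proof.
move=> mkn; rewrite inner_suml (bigD1_seq k) ?mem_index_iota ?iota_uniq//=.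
rewrite innerZl fD.1 eqxx /= big1 ?addr0 1?mulrC// => j jk.
by rewrite innerZl fD.1 (negbTE jk) mulr0.
Qed.

(** Equality may fail because an index outside [D] contributes only to the right-hand side. *)
Lemma frame_sum_sqr (c : nat -> R[i]) m n :
  rnorm (\sum_(m <= j < n) c j *: f j) ^+ 2 <= \sum_(m <= j < n) rnorm (c j) ^+ 2.
Proof.
rewrite -lecR -inner_rnorm inner_sumr rmorph_sum /=.
rewrite big_nat [leRHS]big_nat; apply: ler_sum => k mkn.
rewrite innerZr frame_inner_sum// rnorm_sqr; case: (D k) => /=.
  by rewrite mul1r mulrC.
by rewrite mul0r mulr0 -rnorm_sqr ler0c sqr_ge0.
Qed.

Lemma frame_proj_inner n x y :
  '[frame_proj n x, y] = \sum_(0 <= k < n) '[x, f k] * '[f k, y].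
Proof. by rewrite inner_suml; apply: eq_bigr => k _; rewrite innerZl. Qed.

Lemma frame_proj_inner_id n x :
  '[frame_proj n x, x] = (\sum_(0 <= k < n) rnorm '[x, f k] ^+ 2)%:C.
Proof.
rewrite frame_proj_inner rmorph_sum /=; apply: eq_bigr => k _.
by rewrite rnorm_sqr -innerC.
Qed.

Lemma frame_proj_rnorm n x : rnorm (frame_proj n x) <= rnorm x.
Proof.
have [->|p0] := eqVneq (rnorm (frame_proj n x)) 0; first exact: rnorm_ge0.
have p : 0 < rnorm (frame_proj n x) by rewrite lt_neqAle eq_sym p0 rnorm_ge0.
rewrite -(ler_pM2l p) -expr2 (le_trans (frame_sum_sqr _ _ _))//.
apply: le_trans (CauchySchwarz_inner _ _); rewrite frame_proj_inner_id rnorm_real.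
exact: ler_norm.
Qed.

Lemma frame_parseval x :
  \sum_(0 <= k < n) rnorm '[x, f k] ^+ 2 @[n --> \oo] --> rnorm x ^+ 2.
Proof.
have : '[frame_proj n x, x] @[n --> \oo] --> '[x, x].
  by apply: cvg_innerl; exact: frame_proj_cvg.
move=> /cvg_complexP[+ _].
rewrite inner_rnorm; apply: cvg_trans; apply: near_eq_cvg; apply: nearW => n.
by rewrite /= frame_proj_inner_id.
Qed.

Lemma frame_bessel n x : \sum_(0 <= k < n) rnorm '[x, f k] ^+ 2 <= rnorm x ^+ 2.
Proof.
rewrite -lecR -frame_proj_inner_id.
rewrite lecE frame_proj_inner_id /= eqxx /=.
rewrite (le_trans (ler_norm _))// -rnorm_real -frame_proj_inner_id.
rewrite (le_trans (CauchySchwarz_inner _ _))// expr2 ler_wpM2r ?rnorm_ge0//.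
exact: frame_proj_rnorm.
Qed.

Lemma frame_riesz_fischer (c : nat -> R[i]) (B : R) :
  (forall n, \sum_(0 <= k < n) rnorm (c k) ^+ 2 <= B) ->
  cvg (\sum_(0 <= k < n) c k *: f k @[n --> \oo]).
Proof.
move=> cB; suff : cauchy (series (fun k => c k *: f k) @ \oo)
  by move=> h; exact: (@cauchy_cvg H _ _ h).
apply/cauchy_seriesP => e e0.
have er : e = (complex.Re e)%:C by rewrite RRe_real// gtr0_real.
set d := complex.Re e in er; have d0 : 0 < d by rewrite -ltcR -er.
have [N tail] := bounded_series_tail (fun k => sqr_ge0 (rnorm (c k))) cB
  (exprn_gt0 2 d0).
exists ([set n | (N <= n)%N], setT) => /=; first by split; [exists N|exact: filterT].
move=> [m n] [/= Nm _]; rewrite er -rnormE ltcR.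
rewrite -ltr_sqr ?nnegrE ?rnorm_ge0 ?(ltW d0)//.
by rewrite (le_lt_trans (frame_sum_sqr _ _ _))// tail.
Qed.

(** The witness is [B y], the sum of the [<y, A f_k> f_k]. Pairing [A z] with [y] for a partial sum
    [z] bounds the sum [s] of the squared coefficients by [M |z| |y|], while [|z|^2 <= s]; so
    [s <= (M |y|)^2] and the series converges. *)
Lemma adjoint_exists (A : H -> H) : bounded_op A ->
  forall x y, '[A x, y] = '[x, adjoint A y].
Proof.
move=> bA; have [M M0 AM] := bounded_opP bA; case: bA => linA cA.
have AB y n : \sum_(0 <= k < n) rnorm '[y, A (f k)] ^+ 2 <= (M * rnorm y) ^+ 2.
  pose z := \sum_(0 <= k < n) '[y, A (f k)] *: f k.
  have zAy : '[A z, y] = (\sum_(0 <= k < n) rnorm '[y, A (f k)] ^+ 2)%:C.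
    rewrite (linear_fun_sum linA) inner_suml rmorph_sum /=; apply: eq_bigr => k _.
    by rewrite (linear_funZ linA) innerZl (innerC y) rnorm_sqr.
  have := frame_sum_sqr (fun k => '[y, A (f k)]) 0 n; rewrite -/z.
  set s := \sum_(_ <= _ < _) _ in zAy * => zs.
  have s0 : 0 <= s by rewrite sumr_ge0// => k _; rewrite sqr_ge0.
  have : s <= M * rnorm z * rnorm y.
    rewrite -[s]ger0_norm// -rnorm_real -zAy (le_trans (CauchySchwarz_inner _ _))//.
    by rewrite ler_wpM2r ?rnorm_ge0.
  rewrite mulrAC => sz; have [s1|s1] := eqVneq s 0; first by rewrite s1 sqr_ge0.
  have sp : 0 < s by rewrite lt_neqAle eq_sym s1.
  rewrite -(ler_pM2r sp) -expr2.
  have : s ^+ 2 <= (M * rnorm y * rnorm z) ^+ 2.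
    by rewrite ler_sqr ?nnegrE// !mulr_ge0 ?rnorm_ge0.
  move/le_trans; apply; rewrite exprMn ler_wpM2l ?sqr_ge0//.
pose B y := lim (\sum_(0 <= k < n) '[y, A (f k)] *: f k @[n --> \oo]).
apply: (@getPex _ [set B : H -> H | forall x y, '[A x, y] = '[x, B y]]).
exists B => x y /=.
have Bcvg y := frame_riesz_fischer (AB y).
have lhs : '[A (frame_proj n x), y] @[n --> \oo] --> '[A x, y].
  apply: cvg_innerl; apply: (@cvg_comp _ _ _ (fun n => frame_proj n x) A).
    exact: frame_proj_cvg.
  exact: cA.
suff rhs : '[A (frame_proj n x), y] @[n --> \oo] --> '[x, B y].
  exact: (cvg_unique (@norm_hausdorff _ R[i]) lhs rhs).
apply: cvg_trans (cvg_innerr (y := x) (Bcvg y)).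
apply: near_eq_cvg; apply: nearW => n.
rewrite (linear_fun_sum linA) inner_suml inner_sumr; apply: eq_bigr => k _.
by rewrite (linear_funZ linA) innerZl innerZr -innerC mulrC.
Qed.

End FrameTheory.

Lemma adjointE (A B : H -> H) : (forall x y, '[A x, y] = '[x, B y]) -> adjoint A = B.
Proof.
move=> AB; have /= adjA := @getPex _ [set B : H -> H | forall x y, '[A x, y] = '[x, B y]]
  (ex_intro _ B AB).
apply/funext => y; apply/eqP; rewrite -subr_eq0 -rnorm_eq0 -sqrf_eq0.
by rewrite -(inj_eq (@complexI R)) -inner_rnorm innerBr -AB -adjA subrr.
Qed.

Lemma separable_seq : separable H ->
  exists d : nat -> H, forall x (eps : R), 0 < eps -> exists n, rnorm (x - d n) < eps.
Proof.
move=> [D0 /countable_injP[i injD] denseD].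
pose d n : H := get [set x | D0 x /\ i x = n].
have dx x : D0 x -> d (i x) = x.
  move=> Dx; have [Dd] : D0 (d (i x)) /\ i (d (i x)) = i x.
    by apply: (@getPex _ [set y | D0 y /\ i y = i x]); exists x.
  by apply: injD; rewrite inE.
exists d => x eps eps0; have [||y [xy Dy]] := denseD (ball x eps%:C).
- by exists x; apply: ballxx; rewrite ltcR.
- by apply: ball_open; rewrite ltcR.
exists (i y); rewrite dx// -ltcR rnormE; by move: xy; rewrite -ball_normE.
Qed.

Lemma separable_basis_exists : separable H -> exists D e, @orthonormal_basis R H D e.
Proof.
move=> /separable_seq[d dP].
have lin : linear (fun x : H => x) by [].
have pos : positive_op (fun x : H => x).
  by move=> z; rewrite inner0l inner_rnorm ler0c sqr_ge0.
have [|x eps eps0|g [gg _ gx]] := gram_schmidt (e := d) lin pos ler01.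
- by move=> x; rewrite mul1r.
- have [m xm] := dP x eps eps0; exists m.+1, (fun k => (k == m)%:R).
  rewrite big_nat_recr//= eqxx scale1r big_nat big1 ?add0r// => k /andP[_ km].
  by rewrite (ltn_eqF km) scale0r.
(* The index set leaves out the vectors that Gram-Schmidt made null, which also covers finite
   dimension. *)
exists (fun j => qform (fun x : H => x) (g j) != 0), g; split.
  by move=> m n Dm Dn; rewrite gg Dm andbT.
move=> x; rewrite -[X in _ --> X]subr0.
apply: cvg_trans (cvgB (cvg_cst x) (gx x)); apply: near_eq_cvg.
apply: nearW => n /=; rewrite fctE opprB addrC subrK [RHS]big_mkcond.
apply: eq_bigr => k _; case: eqVneq => // gk0 /=.
by rewrite (qform_eq0_inner lin pos) ?scale0r.
Qed.

End Frames.

(** * Trace-class operators *)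

Lemma cvg_finite_sum {K : numFieldType} {V : normedModType K} {T : Type}
    {F : set_system T} {FF : Filter F} (t : nat -> T -> V) (l : nat -> V) N :
  (forall j, t j k @[k --> F] --> l j) ->
  \sum_(0 <= j < N) t j k @[k --> F] --> \sum_(0 <= j < N) l j.
Proof.
move=> tl; elim: N => [|N IH].
  by rewrite big_nil; apply: cvg_near_cst; apply: nearW => k; rewrite big_nil.
rewrite big_nat_recr//=; apply: cvg_trans (cvgD IH (tl N)).
by apply: near_eq_cvg; apply: nearW => k; rewrite big_nat_recr.
Qed.

Section Tannery.
Context {R : realType}.

Lemma cvg_rnorm_le {V : normedModType R[i]} (u : nat -> V) (l a : V) (r : R) N :
  u n @[n --> \oo] --> l -> (forall n, (N <= n)%N -> rnorm (u n - a) <= r) ->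
  rnorm (l - a) <= r.
Proof.
move=> /cvg_rnormP ul ur; apply/ler_addgt0Pr => e e0.
have [N' _ /(_ (maxn N N') (leq_maxr _ _)) h] := ul e e0.
rewrite -(subrK (u (maxn N N')) l) -addrA (le_trans (rnormD _ _))// [r + e]addrC lerD//.
  exact: ltW.
by rewrite ur// leq_maxl.
Qed.

Lemma dominated_series_cvg (u b : nat -> R) (B : R) :
  (forall n, `|u n| <= b n) -> (forall n, \sum_(0 <= k < n) b k <= B) ->
  cvg (\sum_(0 <= k < n) u k @[n --> \oo]).
Proof.
move=> ub bB; apply: (@normed_cvg R R u).
suff : cvg (\sum_(0 <= k < n) `|u k| @[n --> \oo]) by [].
apply: (@nondecreasing_is_cvgn R).
  by apply/nondecreasing_seqP => n; rewrite big_nat_recr//= lerDl.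
exists B => _ [n _ <-]; apply: le_trans (bB n).
exact: ler_sum.
Qed.

Lemma dominated_complex_series_cvg (u : nat -> R[i]) (b : nat -> R) (B : R) :
  (forall n, rnorm (u n) <= b n) -> (forall n, \sum_(0 <= k < n) b k <= B) ->
  exists l : R[i], \sum_(0 <= k < n) u k @[n --> \oo] --> l.
Proof.
move=> ub bB.
have /cvg_ex[x ux] := dominated_series_cvg
  (fun n => le_trans (Re_le_rnorm (u n)) (ub n)) bB.
have /cvg_ex[y uy] := dominated_series_cvg
  (fun n => le_trans (Im_le_rnorm (u n)) (ub n)) bB.
exists (x +i* y); apply/cvg_complexP => /=; split.
  by apply: cvg_trans ux; apply: near_eq_cvg; apply: nearW => n; rewrite raddf_sum.
by apply: cvg_trans uy; apply: near_eq_cvg; apply: nearW => n; rewrite raddf_sum.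
Qed.

(** Dominated convergence for series. Beyond [N] the bounds [b] sum to less than [e / 4], so each of
    the two tails and the finite part contributes at most [e / 4]. *)
Lemma tannery (t : nat -> nat -> R[i]) (l s : nat -> R[i]) (b : nat -> R) (B : R) :
  (forall n, \sum_(0 <= j < n) b j <= B) -> (forall j k, rnorm (t j k) <= b j) ->
  (forall k, \sum_(0 <= j < n) t j k @[n --> \oo] --> s k) ->
  (forall j, t j k @[k --> \oo] --> l j) ->
  exists2 S : R[i], \sum_(0 <= j < n) l j @[n --> \oo] --> S & s k @[k --> \oo] --> S.
Proof.
move=> bB tb ts tl.
have b0 j : 0 <= b j := le_trans (rnorm_ge0 _) (tb j 0%N).
have lb j : rnorm (l j) <= b j.
  rewrite -[l j]subr0; apply: (cvg_rnorm_le (N := 0) (tl j)) => k _.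
  by rewrite subr0.
have [S lS] := dominated_complex_series_cvg lb bB; exists S => //.
apply/cvg_rnormP => e e0; have e4 : 0 < e / 4 by rewrite divr_gt0.
have [N tail] := bounded_series_tail b0 bB e4.
have tailE (u : nat -> R[i]) (L : R[i]) : (forall j, rnorm (u j) <= b j) ->
    \sum_(0 <= j < n) u j @[n --> \oo] --> L ->
    rnorm (L - \sum_(0 <= j < N) u j) <= e / 4.
  move=> ub uL; apply: (cvg_rnorm_le (N := N) uL) => n Nn.
  rewrite [X in X - _](big_cat_nat _ Nn)//= addrAC subrr add0r.
  rewrite (le_trans (rnorm_sum _ _ _))// (le_trans _ (ltW (tail N n (leqnn N))))//.
  exact: ler_sum.
have : \sum_(0 <= j < N) t j k @[k --> \oo] --> \sum_(0 <= j < N) l j.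
  by apply: cvg_finite_sum.
move=> /cvg_rnormP/(_ _ e4).
apply: filterS => k tk.
have h1 := tailE _ _ lb lS; have h2 := tailE _ _ (fun j => tb j k) (ts k).
set A := \sum_(0 <= j < N) l j in tk h1; set A' := \sum_(_ <= _ < _) _ in tk h2.
have -> : S - s k = (S - A) + (A - A') - (s k - A') by ring.
rewrite (le_lt_trans (rnormD _ _))// rnormN.
have := rnormD (S - A) (A - A'); lra.
Qed.

End Tannery.

Section Trace.
Context {R : realType} {H : hilbertType R}.
Implicit Types (A T P : H -> H) (v w : nat -> H).

(* [T] is the sum of the rank-one operators [<., w j> v j]. *)
Definition nuclear T v w :=
  (exists B : R, forall n, \sum_(0 <= j < n) rnorm (v j) * rnorm (w j) <= B) /\
  forall x, \sum_(0 <= j < n) '[x, w j] *: v j @[n --> \oo] --> T x.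

Lemma bounded_op_of_bound A (M : R) : linear A ->
  (forall x, rnorm (A x) <= M * rnorm x) -> bounded_op A.
Proof.
move=> linA AM; split => // x; apply/cvg_rnormP => e e0.
have M1 : 0 < `|M| + 1 by rewrite ltr_wpDl.
have : y @[y --> x] --> x by [].
move=> /cvg_rnormP/(_ _ (divr_gt0 e0 M1)); apply: filterS => y.
rewrite ltr_pdivlMr// => h; rewrite -(linear_funB linA).
rewrite (le_lt_trans (AM _))// (le_lt_trans _ h)// mulrC ler_wpM2l ?rnorm_ge0//.
by rewrite (le_trans (ler_norm _))// lerDl.
Qed.

(* The partial sums of the trace are [sum_j <A p_n (v j), w j>] for the
   projection [p_n] on the first [n] basis vectors. *)
Lemma nuclear_trace_frame D f T v w A : frame D f -> nuclear T v w ->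
  bounded_op A ->
  exists2 t : R[i], \sum_(0 <= j < n) '[A (v j), w j] @[n --> \oo] --> t &
    \sum_(0 <= k < n) '[T (A (f k)), f k] @[n --> \oo] --> t.
Proof.
move=> fD [[B vwB] Tvw] bA; have [M M0 AM] := bounded_opP bA.
have [linA cA] := bA.
apply: (@tannery R (fun j n => '[A (frame_proj f n (v j)), w j])
  (fun j => '[A (v j), w j]) _ (fun j => M * (rnorm (v j) * rnorm (w j))) (M * B)).
- by move=> n; rewrite -mulr_sumr ler_wpM2l.
- move=> j n; rewrite (le_trans (CauchySchwarz_inner _ _))// mulrA.
  rewrite ler_wpM2r ?rnorm_ge0// (le_trans (AM _))// ler_wpM2l//.
  exact: (frame_proj_rnorm fD).
- move=> n; have : \sum_(0 <= k < n) (\sum_(0 <= j < m) '[A (f k), w j] * '[v j, f k])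
      @[m --> \oo] --> \sum_(0 <= k < n) '[T (A (f k)), f k].
    apply: (@cvg_finite_sum R[i] R[i] _ _ _
      (fun k m => \sum_(0 <= j < m) '[A (f k), w j] * '[v j, f k])).
    move=> k; apply: cvg_trans (cvg_innerl (y := f k) (Tvw (A (f k)))).
    apply: near_eq_cvg; apply: nearW => m.
    by rewrite inner_suml; apply: eq_bigr => j _; rewrite innerZl.
  apply: cvg_trans; apply: near_eq_cvg; apply: nearW => m.
  rewrite exchange_big_nat /=; apply: eq_bigr => j _.
  rewrite (linear_fun_sum linA) inner_suml; apply: eq_bigr => k _.
  by rewrite (linear_funZ linA) innerZl mulrC.
- move=> j; apply: cvg_innerl.
  apply: (@cvg_comp _ _ _ (fun n => frame_proj f n (v j)) A).
    exact: (frame_proj_cvg fD).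
  exact: cA.
Qed.

Lemma orthonormal_basis_traceE D e T n : T 0 = 0 ->
  \sum_(0 <= k < n) '[T (if D k then e k else 0), if D k then e k else 0] =
  \sum_(0 <= k < n | D k) '[T (e k), e k].
Proof.
move=> T0; rewrite [RHS]big_mkcond; apply: eq_bigr => k _.
by case: ifP; rewrite ?inner0r.
Qed.

Hypothesis Hsep : separable H.

(** The series involves no basis, so its limit is common to the diagonal sums in all orthonormal
    bases; the existence of one basis makes this common value unique, hence equal to [trace]. *)
Lemma trace_nuclear T v w A : nuclear T v w -> bounded_op A ->
  \sum_(0 <= j < n) '[A (v j), w j] @[n --> \oo] --> trace (T \o A).
Proof.
move=> Tvw bA; have [linA cA] := bA.
have T0 : T 0 = 0.
  apply: (cvg_unique (@norm_hausdorff _ H) (Tvw.2 0)).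
  apply: cvg_near_cst; apply: nearW => n; rewrite big1// => j _.
  by rewrite inner0l scale0r.
have [D [e De]] := separable_basis_exists Hsep.
have [t vt _] := nuclear_trace_frame (orthonormal_basis_frame De) Tvw bA.
pose Q := [set t : R[i] | forall D e, orthonormal_basis D e ->
    (\sum_(0 <= k < n | D k) '[T (A (e k)), e k]) @[n --> \oo] --> t].
have Qt : Q t.
  move=> D' e' De'.
  have [t' vt' fT] := nuclear_trace_frame (orthonormal_basis_frame De') Tvw bA.
  have -> : t = t' by exact: (cvg_unique (@norm_hausdorff _ R[i]) vt vt').
  apply: cvg_trans fT; apply: near_eq_cvg; apply: nearW => n.
  by rewrite (@orthonormal_basis_traceE D' e' (T \o A))//= (linear_fun0 linA).
have : Q (trace (T \o A)) by apply: getPex; exists t.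
move=> /(_ D e De); have := Qt D e De.
move=> h1 h2; have <- // : t = trace (T \o A).
exact: (cvg_unique (@norm_hausdorff _ R[i]) h1).
Qed.

End Trace.

Section TraceClass.
Context {R : realType} {H : hilbertType R}.
Implicit Types (A T P : H -> H) (x y : H).

(* Cholesky: [P = sum_j <., P g_j> P g_j] for the vectors [g] obtained by
   orthonormalizing a basis with respect to [<P ., .>]; the partial isometry
   between [P x] and [T x] carries this over to [T]. *)
Lemma nuclear_of_positive D f P T (B : R) : frame D f ->
  bounded_op P -> positive_op P -> linear T ->
  (forall x, rnorm (T x) = rnorm (P x)) ->
  (forall n, \sum_(0 <= k < n) qform P (f k) <= B) ->
  exists g, nuclear T (T \o g) (P \o g).
Proof.
move=> fD bP posP linT TP qB; have [M M0 PM] := bounded_opP bP.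
have [linP cP] := bP.
have [|g [_ gq gx]] := gram_schmidt (e := f) linP posP M0 PM.
  move=> x eps eps0; have /cvg_rnormP/(_ _ eps0)[N _ Nx] := frame_proj_cvg fD (x := x).
  by exists N, (fun k => '[x, f k]); exact: (Nx N (leqnn N)).
exists g; split.
- exists B => n.
  (* Parseval expands the square norms of the [P (g j)] in the basis [f]; after exchanging the sums,
     the Bessel inequality [gq] bounds the terms in [f k] by [qform P (f k)]. *)
  have Pg : \sum_(0 <= j < n) \sum_(0 <= k < m) rnorm '[P (g j), f k] ^+ 2
      @[m --> \oo] --> \sum_(0 <= j < n) rnorm (P (g j)) ^+ 2.
    apply: (@cvg_finite_sum R R _ _ _
      (fun j m => \sum_(0 <= k < m) rnorm '[P (g j), f k] ^+ 2)).
    by move=> j; exact: (frame_parseval fD).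
  under eq_bigr do rewrite /= TP -expr2.
  rewrite -(cvg_lim (@Rhausdorff R) Pg); apply: limr_le.
    by apply/cvg_ex; eexists; exact: Pg.
  apply: nearW => m; rewrite exchange_big_nat /=; apply: le_trans (qB m).
  apply: ler_sum => k _; apply: le_trans (gq (f k) n); rewrite le_eqVlt.
  apply/orP; left; apply/eqP; apply: eq_bigr => j _.
  by rewrite innerC rnorm_conj.
- move=> x; rewrite -[X in _ --> X](subr0 (T x)).
  have := gx x => /cvg_rnormP gx0.
  apply/cvg_rnormP => e /gx0; apply: filterS => n.
  rewrite sub0r rnormN -TP subr0 (linear_funB linT) (linear_fun_sum linT).
  by congr (rnorm (_ - _) < _); apply: eq_bigr => j _; rewrite (linear_funZ linT).
Qed.

Lemma positive_op_qform_sum D f T (t : R[i]) : positive_op T -> frame D f ->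
  \sum_(0 <= k < n) '[T (f k), f k] @[n --> \oo] --> t ->
  forall n, \sum_(0 <= k < n) qform T (f k) <= complex.Re t.
Proof.
move=> posT fD /cvg_complexP[/= Tt _] n.
have Tt' : \sum_(0 <= k < n) qform T (f k) @[n --> \oo] --> complex.Re t.
  apply: cvg_trans Tt; apply: near_eq_cvg; apply: nearW => m.
  by rewrite raddf_sum.
rewrite -(cvg_lim (@Rhausdorff R) Tt').
apply: (@nondecreasing_cvgn_le R (fun n => \sum_(0 <= k < n) qform T (f k))).
  by apply/nondecreasing_seqP => m; rewrite big_nat_recr//= lerDl qform_ge0.
by apply/cvg_ex; exists (complex.Re t).
Qed.

(** A decomposition with equal left and right vectors writes [Tr (T A)] as a sum of diagonal values
    of [A], which shows its sign. Taking [P = T] avoids identifying [T] with [|T|]. *)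
Lemma positive_trace_class_nuclear T : positive_op T -> bounded_op T ->
  forall v w, nuclear T v w -> separable H -> exists u, nuclear T u u.
Proof.
move=> posT bT v w Tvw /separable_basis_exists[D [e De]].
have bid : bounded_op (fun x : H => x) by split => [//|x]; exact: cvg_id.
have fD := orthonormal_basis_frame De.
have [t _ Tt] := nuclear_trace_frame fD Tvw bid.
have [g gT] := nuclear_of_positive fD bT posT bT.1 (fun=> erefl)
  (positive_op_qform_sum posT fD Tt).
by exists (T \o g).
Qed.

Lemma trace_class_nuclear T : trace_class T -> exists v w, nuclear T v w.
Proof.
move=> [bT [P [bP posP PP] [D [e [De Psum]]]]].
have fD := orthonormal_basis_frame De.
have adjT := adjoint_exists fD bT.
(* Both square norms are values of [P \o P = adjoint T \o T] on the diagonal. *)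
have TP x : rnorm (T x) = rnorm (P x).
  apply/eqP; rewrite -(@eqrXn2 _ 2) ?rnorm_ge0// -(inj_eq (@complexI R)).
  rewrite -!inner_rnorm adjT -[adjoint T (T x)]/((adjoint T \o T) x) -PP /=.
  by rewrite [eqbRHS](positive_op_sym bP.1 posP) -innerC.
pose q k := qform P (if D k then e k else 0).
have q0 k : (0 <= (q k)%:E)%E by rewrite lee_fin qform_ge0.
have qsum : (\sum_(0 <= k <oo) (q k)%:E < +oo)%E.
  apply: le_lt_trans Psum; rewrite [leRHS]eseries_mkcond; apply: lee_nneseries => //.
  move=> k _; rewrite /q /qform; case: ifP => // _.
  by rewrite inner0r lexx.
have [g gT] : exists g, nuclear T (T \o g) (P \o g).
  apply: (nuclear_of_positive (B := fine (\sum_(0 <= k <oo) (q k)%:E)%E)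
    fD bP posP bT.1 TP).
  move=> n; rewrite -lee_fin fineK; last first.
    by rewrite ge0_fin_numE// nneseries_ge0.
  by rewrite -sumEFin; apply: nneseries_lim_ge => k _ _; exact: q0.
by exists (T \o g), (P \o g).
Qed.

(** Testing ultraweak convergence against these operators gives convergence of [<A x, x>], hence
    countable additivity of [<E(.) x, x>]. *)
Definition rank_one x y : H := '[y, x] *: x.

Lemma rank_one_linear x : linear (rank_one x).
Proof. by move=> a y z; rewrite /rank_one innerDl innerZl scalerDl scalerA. Qed.

Lemma rank_one_positive x : positive_op (rank_one x).
Proof.
move=> y; rewrite inner0l /rank_one innerZl (innerC y x) -rnorm_sqr.
by rewrite ler0c sqr_ge0.
Qed.

Lemma rank_one_bounded x : bounded_op (rank_one x).
Proof.
apply: (bounded_op_of_bound (M := rnorm x ^+ 2)); first exact: rank_one_linear.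
move=> y; rewrite rnormZ expr2 mulrAC ler_wpM2r ?rnorm_ge0//.
by rewrite mulrC CauchySchwarz_inner.
Qed.

Lemma rank_one_trace_class x : separable H -> trace_class (rank_one x).
Proof.
move=> /separable_basis_exists[D [e De]]; split; first exact: rank_one_bounded.
exists (rank_one x).
  split; [exact: rank_one_bounded|exact: rank_one_positive|].
  congr (_ \o _); apply/esym/adjointE => y z.
  by rewrite /rank_one innerZl innerZr (innerC z x) mulrC.
exists D, e; split => //.
have fD := orthonormal_basis_frame De.
apply: (@le_lt_trans _ _ (rnorm x ^+ 2)%:E); last exact: ltry.
apply: lime_le.
  apply: is_cvg_nneseries => k _ _; rewrite lee_fin.
  exact: (qform_ge0 (@rank_one_positive x)).
apply: nearW => n; apply: le_trans
  (_ : (\sum_(0 <= k < n) rnorm '[x, if D k then e k else 0] ^+ 2)%:E <= _)%E;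
  last first.
  by rewrite lee_fin; exact: (frame_bessel fD).
rewrite -sumEFin big_mkcond /=; apply: lee_sum => k _.
case: ifP => _; last by rewrite lee_fin sqr_ge0.
rewrite lee_fin /rank_one innerZl (innerC (e k) x) -rnorm_sqr.
by rewrite -(rnorm_conj '[_, _]) -innerC.
Qed.

Lemma rank_one_nuclear x : exists v w, [/\ nuclear (rank_one x) v w,
  v 0%N = x, w 0%N = x & forall n, (0 < n)%N -> v n = 0].
Proof.
exists (fun n => if n == 0%N then x else 0), (fun n => if n == 0%N then x else 0).
split => //; last by case.
split.
  exists (rnorm x * rnorm x) => -[|n]; first by rewrite big_nil mulr_ge0 ?rnorm_ge0.
  by rewrite big_nat_recl//= big1 ?addr0// => i _; rewrite rnorm0 mulr0.
move=> y; apply: cvg_near_cst; exists 1%N => // -[//|n] _.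
by rewrite big_nat_recl//= big1 ?addr0// => i _; rewrite scaler0.
Qed.

Lemma trace_rank_one x A : separable H -> bounded_op A ->
  trace (rank_one x \o A) = '[A x, x].
Proof.
move=> sepH bA; have [v [w [vw v0 w0 vn]]] := rank_one_nuclear x.
have := trace_nuclear sepH vw bA.
have : \sum_(0 <= j < n) '[A (v j), w j] @[n --> \oo] --> '[A x, x].
  apply: cvg_near_cst; exists 1%N => // -[//|n] _.
  rewrite big_nat_recl//= v0 w0 big1 ?addr0// => i _.
  by rewrite vn// (linear_fun0 bA.1) inner0l.
move=> h1 h2; exact: (cvg_unique (@norm_hausdorff _ R[i]) h2 h1).
Qed.

End TraceClass.

(** * Covariant POVMs *)

Section PositiveIntegrals.
Context {d} {T : measurableType d} {R : realType}.
Variable mu : {measure set T -> \bar R}.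
Local Open Scope ereal_scope.

(** On the set where [f < 0], the integral of [|f|] is minus that of [f], hence zero; so [f]
    vanishes almost everywhere on it, and the set is null. *)
Lemma ae_ge0_of_integral_ge0 (f : T -> R) :
  mu.-integrable setT (EFin \o f) ->
  (forall A, measurable A -> (0 <= \int[mu]_(x in A) f x)%R) ->
  {ae mu, forall x, (0 <= f x)%R}.
Proof.
move=> fi fA; have mf : measurable_fun setT f.
  by apply/measurable_EFinP; exact: measurable_int fi.
pose A := [set x | (f x < 0)%R].
have mA : measurable A.
  by rewrite -[A]setTI; exact: (measurable_fun_ltr mf (measurable_cst _)).
have fiA : mu.-integrable A (EFin \o f) := integrableS measurableT mA (@subsetT _ _) fi.
have intA : \int[mu]_(x in A) `|(f x)%:E| = 0.
  apply/eqP; rewrite eq_le integral_ge0// andbT.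
  rewrite (eq_integral (fun x => - (f x)%:E)); last first.
    by move=> x; rewrite inE => /ltW fx; rewrite lee0_abs.
  rewrite (integralN (f := EFin \o f)); last exact: (integrable_add_def mA fiA).
  have := fA A mA; rewrite /Rintegral => h.
  rewrite -(fineK (integrable_fin_num mA fiA)) leeNl oppe0 lee_fin //.
have mfA : measurable_fun A (EFin \o f) := measurable_int _ fiA.
have [/(_ intA) + _] := ae_eq_integral_abs mu mA mfA.
apply: filterS => x fx; rewrite leNgt; apply/negP => fx0.
by have /= [fx1] := fx fx0; rewrite fx1 ltxx in fx0.
Qed.

End PositiveIntegrals.

Lemma continuous_borel_measurable (X Y : ptopologicalType) (f : X -> Y)
    (W : set (borel Y)) :
  continuous f -> measurable W -> measurable (f @^-1` W : set (borel X)).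
Proof.
move=> cf mW; have mf : measurable_fun setT (f : borel X -> borel Y).
  apply: (@measurability _ _ (borel X) (borel Y) setT f (@open Y)) => // _ [V oV <-].
  rewrite setTI; apply: sub_sigma_algebra; apply: open_comp => // x _; exact: cf.
by rewrite -[X in measurable X]setTI; exact: mf.
Qed.

Section POVM.
Context {R : realType} {H : hilbertType R} {S : ptopologicalType}.
Variable E : set (borel S) -> H -> H.
Hypotheses (Hsep : separable H) (HE : povm E).

Lemma bounded_op_sum n (A : nat -> H -> H) : (forall k, bounded_op (A k)) ->
  bounded_op (fun x => \sum_(0 <= k < n) A k x).
Proof.
move=> bA; split.
  move=> a x y; rewrite scaler_sumr -big_split /=; apply: eq_bigr => k _.
  by have [linA _] := bA k; rewrite linA.
move=> x; apply: (@cvg_finite_sum _ _ _ _ _ A) => k.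
by have [_ cA] := bA k; exact: cA.
Qed.

(** [trace] is a chosen limit, not linear by construction; its additivity on the partial sums is
    read off the series of [trace_nuclear]. *)
Lemma povm_measure_additive chi (F : nat -> set (borel S)) : trace_class chi ->
  (forall n, measurable (F n)) -> trivIset setT F ->
  \sum_(0 <= k < n) povm_measure E chi (F k) @[n --> \oo] -->
    povm_measure E chi (\bigcup_n F n).
Proof.
move=> tchi mF tF; have [effE _ addE] := HE.
have [v [w vw]] := trace_class_nuclear tchi.
have bE k : bounded_op (E (F k)) by have [] := effE _ (mF k).
suff -> : (fun n => \sum_(0 <= k < n) povm_measure E chi (F k)) =
    (fun n => trace (chi \o (fun x => \sum_(0 <= k < n) E (F k) x))).
  exact: addE.
apply/funext => n; apply/esym.
have h1 := trace_nuclear Hsep vw (bounded_op_sum n bE).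
have h2 := cvg_finite_sum (F := \oo) (N := n) (fun k => trace_nuclear Hsep vw (bE k)).
suff h3 : \sum_(0 <= j < m) '[\sum_(0 <= k < n) E (F k) (v j), w j] @[m --> \oo]
    --> \sum_(0 <= k < n) povm_measure E chi (F k).
  exact: (cvg_unique (@norm_hausdorff _ R[i]) h1 h3).
suff -> : (fun m => \sum_(0 <= j < m) '[\sum_(0 <= k < n) E (F k) (v j), w j]) =
    (fun m => \sum_(0 <= k < n) \sum_(0 <= j < m) '[E (F k) (v j), w j]).
  exact: h2.
apply/funext => m; rewrite exchange_big_nat /=; apply: eq_bigr => j _.
by rewrite inner_suml.
Qed.

Lemma povm_measure_set0 chi : trace_class chi -> povm_measure E chi set0 = 0.
Proof.
move=> tchi; have [effE E0 _] := HE; have [v [w vw]] := trace_class_nuclear tchi.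
have bE : bounded_op (E set0) by have [] := effE _ measurable0.
have := trace_nuclear Hsep vw bE; rewrite /povm_measure => h.
suff h0 : \sum_(0 <= j < n) '[E set0 (v j), w j] @[n --> \oo] --> (0 : R[i]).
  exact: (cvg_unique (@norm_hausdorff _ R[i]) h h0).
by apply: cvg_near_cst; apply: nearW => n; rewrite big1// => j _; rewrite E0 inner0l.
Qed.

(* The absolute value only matters at non-measurable sets, where [E] is
   unconstrained. *)
Definition povm_vector_measure of povm E & separable H :=
  fun (x : H) (X : set (borel S)) => (`|complex.Re '[E X x, x]|)%:E : \bar R.

Section VectorMeasure.
Variable x : H.
Local Notation nu := (povm_vector_measure HE Hsep x).

Let nu0 : nu set0 = 0%E.
Proof.
by have [_ E0 _] := HE; rewrite /povm_vector_measure E0 inner0l normr0.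
Qed.

Let nu_ge0 X : (0 <= nu X)%E. Proof. by rewrite lee_fin. Qed.

Let nuE X : measurable X -> povm_measure E (rank_one x) X = '[E X x, x].
Proof.
move=> mX; have [effE _ _] := HE; have [bE _ _] := effE X mX.
exact: trace_rank_one.
Qed.

Let nu_ReE X : measurable X -> nu X = (complex.Re '[E X x, x])%:E.
Proof.
move=> mX; have [effE _ _] := HE; have [_ pE _] := effE X mX.
by rewrite /povm_vector_measure ger0_norm// (qform_ge0 pE).
Qed.

Let nu_additive : semi_sigma_additive nu.
Proof.
move=> F mF tF mUF; rewrite nu_ReE// -nuE//.
have /cvg_complexP[FRe _] := povm_measure_additive (rank_one_trace_class x Hsep) mF tF.
have -> : (fun n => \sum_(0 <= i < n) nu (F i))%E = EFin \o (fun n =>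
    complex.Re (\sum_(0 <= k < n) povm_measure E (rank_one x) (F k))).
  apply/funext => n /=; rewrite raddf_sum -sumEFin; apply: eq_bigr => i _ /=.
  by rewrite nu_ReE// nuE.
by apply: cvg_EFin FRe; exact: nearW.
Qed.

HB.instance Definition _ := isMeasure.Build _ (borel S) R nu nu0 nu_ge0 nu_additive.

End VectorMeasure.

Section TraceCharges.
Variables (chi : H -> H) (tchi : trace_class chi).

(** Radon-Nikodym is applied to signed measures, hence the split into real and imaginary parts. The
    proofs are arguments for the sake of the charge instances. *)
Definition povm_charge_Re of povm E & separable H & trace_class chi :=
  fun X : set (borel S) => (complex.Re (povm_measure E chi X))%:E : \bar R.

Definition povm_charge_Im of povm E & separable H & trace_class chi :=
  fun X : set (borel S) => (complex.Im (povm_measure E chi X))%:E : \bar R.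

Let Re0 : povm_charge_Re HE Hsep tchi set0 = 0%E.
Proof. by rewrite /povm_charge_Re povm_measure_set0. Qed.

Let Im0 : povm_charge_Im HE Hsep tchi set0 = 0%E.
Proof. by rewrite /povm_charge_Im povm_measure_set0. Qed.

Let Re_fin X : measurable X -> povm_charge_Re HE Hsep tchi X \is a fin_num.
Proof. by []. Qed.

Let Im_fin X : measurable X -> povm_charge_Im HE Hsep tchi X \is a fin_num.
Proof. by []. Qed.

Let Re_additive : semi_sigma_additive (povm_charge_Re HE Hsep tchi).
Proof.
move=> F mF tF mUF; have /cvg_complexP[FRe _] := povm_measure_additive tchi mF tF.
have -> : (fun n => \sum_(0 <= i < n) povm_charge_Re HE Hsep tchi (F i))%E =
    EFin \o (fun n => complex.Re (\sum_(0 <= k < n) povm_measure E chi (F k))).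
  by apply/funext => n /=; rewrite raddf_sum -sumEFin.
by apply: cvg_EFin FRe; exact: nearW.
Qed.

Let Im_additive : semi_sigma_additive (povm_charge_Im HE Hsep tchi).
Proof.
move=> F mF tF mUF; have /cvg_complexP[_ FIm] := povm_measure_additive tchi mF tF.
have -> : (fun n => \sum_(0 <= i < n) povm_charge_Im HE Hsep tchi (F i))%E =
    EFin \o (fun n => complex.Im (\sum_(0 <= k < n) povm_measure E chi (F k))).
  by apply/funext => n /=; rewrite raddf_sum -sumEFin.
by apply: cvg_EFin FIm; exact: nearW.
Qed.

HB.instance Definition _ := isCharge.Build _ (borel S) R
  (povm_charge_Re HE Hsep tchi) Re0 Re_fin Re_additive.

HB.instance Definition _ := isCharge.Build _ (borel S) R
  (povm_charge_Im HE Hsep tchi) Im0 Im_fin Im_additive.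

End TraceCharges.

End POVM.

Lemma Radon_Nikodym_real d (T : measurableType d) (R : realType)
    (nu : {charge set T -> \bar R}) (mu : {measure set T -> \bar R}) :
  sigma_finite setT mu -> nu `<< mu ->
  exists f : T -> R, mu.-integrable setT (EFin \o f) /\
    forall A, measurable A -> nu A = (\int[mu]_(x in A) f x)%:E.
Proof.
move=> mu_sfin numu.
pose mu' := [the {sigma_finite_measure set T -> \bar R} of sfin_measure mu_sfin].
pose g := Radon_Nikodym nu mu'.
have gE : EFin \o (fine \o g) = g.
  by apply/funext => x /=; rewrite fineK// Radon_Nikodym_fin_num.
exists (fine \o g); rewrite gE; split.
  exact: (Radon_Nikodym_integrable (mu := mu') numu).
move=> A mA; have nuA := Radon_Nikodym_integral (mu := mu') numu mA.
rewrite -[LHS]fineK; last exact: fin_num_measure.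
by rewrite nuA -/g -[in LHS]gE.
Qed.

(** * Absolute continuity and densities *)

Section CovariantPOVM.
Context {R : realType} {H : hilbertType R} {G : topologicalGroupType}
  {S : ptopologicalType}.
Variables (act : G -> S -> S) (E : set (borel S) -> H -> H).
Variable mu : {measure set (borel S) -> \bar R}.
Hypotheses (Hsep : separable H) (Glc : locally_compact [set: G])
  (Gsc : @second_countable G) (Ghaus : hausdorff_space G)
  (Ssc : @second_countable S) (act_cont : continuous_action act)
  (act_trans : transitive_action act) (mu_sfin : sigma_finite setT mu)
  (mu_neq0 : mu setT <> 0%E) (mu_qinv : quasi_invariant act mu)
  (HE : povm E) (E_cov : covariant E act).

Lemma act_image g (X : set S) : act g @` X = [set s | X (act g^-1%g s)].
Proof.
have [act1 actM _] := act_cont.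
apply/seteqP; split => [_ [s Xs <-]|s Xs] /=.
  by rewrite -actM mulVg act1.
by exists (act g^-1%g s) => //; rewrite -actM mulgV act1.
Qed.

Lemma measurable_act_image g (X : set (borel S)) : measurable X ->
  measurable (act g @` X : set (borel S)).
Proof.
have [_ _ actC] := act_cont.
rewrite act_image; apply: (@continuous_borel_measurable S S (act g^-1%g)).
move=> s; apply: (@continuous_comp _ _ _ (fun s : S => (g^-1%g, s))
  (fun p : G * S => act p.1 p.2)); last exact: actC.
by apply: cvg_pair; [exact: cvg_cst|exact: cvg_id].
Qed.

Lemma bounded_positive_op_eq0 (A : H -> H) x : bounded_op A -> positive_op A ->
  '[A x, x] = 0 -> A x = 0.
Proof.
move=> bA pA Ax; have [M M0 AM] := bounded_opP bA.
have := positive_op_rnorm_le bA.1 pA M0 AM x.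
rewrite /qform Ax mulr0 => h; apply/eqP.
by rewrite -rnorm_eq0 -sqrf_eq0 eq_le h sqr_ge0.
Qed.

(* Some translate [g X] has [<E (g X) x, x> = 0] for all [x] in a dense
   sequence; then [E (g X) = 0], and [E X] is unitarily equivalent to it. *)
Lemma covariant_povm_null (X : set (borel S)) :
  measurable X -> mu X = 0%E -> E X = (fun=> 0).
Proof.
move=> mX muX.
have [h [h_sfin h_neq0 h_inv]] := haar_measure_exists R Glc Gsc Ghaus.
have [d dP] := separable_seq Hsep.
have aen n : {ae h, forall g : pgroup G,
    povm_vector_measure HE Hsep (d n) [set s | X (act (g : G)^-1%g s)] = 0%E}.
  apply: (@null_translates_ae _ _ _ _ Gsc Ssc act_cont act_trans h h_sfin h_inv mu
    [the {measure set (borel S) -> \bar R} of povm_vector_measure HE Hsep (d n)]) => //.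
    by apply: fin_num_fun_sigma_finite => //; rewrite measure0.
  by move=> g; rewrite -act_image; apply/(mu_qinv g mX).
(* The exceptional sets for the [d n] have a null union, which cannot be all of [G]. *)
have [g gX] : exists g : G, forall n,
    povm_vector_measure HE Hsep (d n) (act g @` X) = 0%E.
  apply: contrapT => /forallNP hg; apply: h_neq0.
  have : h.-negligible setT.
    have := ae_foralln aen; rewrite /almost_everywhere.
    congr (h.-negligible _); apply/seteqP; split => // g _ hgn; apply: (hg g) => n.
    by rewrite act_image; exact: hgn.
  by move=> /negligibleP; exact.
have [effE _ _] := HE; have [bE pE _] := effE _ (measurable_act_image g mX).
have EgX : E (act g @` X) = (fun=> 0).
  have Ed n : E (act g @` X) (d n) = 0.
    apply: bounded_positive_op_eq0 => //.
    have [/eqP] := gX n; rewrite normr_eq0 => /eqP Re0.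
    by rewrite (qformE pE) /qform Re0.
  have [M M0 EM] := bounded_opP bE.
  apply/funext => x; apply/eqP; rewrite -rnorm_eq0 eq_le rnorm_ge0 andbT.
  apply/ler_addgt0Pr => e e0; rewrite add0r.
  have M1 : 0 < M + 1 by rewrite ltr_wpDl.
  have [n /ltW xn] := dP x _ (divr_gt0 e0 M1).
  rewrite -[E _ x]subr0 -(Ed n) -(linear_funB bE.1) (le_trans (EM _))//.
  apply: (@le_trans _ _ ((M + 1) * rnorm (x - d n))).
    by rewrite ler_wpM2r ?rnorm_ge0// lerDl.
  by rewrite mulrC -ler_pdivlMr.
have [U [Uunit _ _ _] UE] := E_cov.
have [[linU _] UU _] := Uunit g.
(* Since [U g 0 = 0], the identity [adjoint (U g) \o U g = idfun] at [0] suffices. *)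
have adj0 : adjoint (U g) 0 = 0.
  by have := congr1 (@^~ 0) UU; rewrite /= (linear_fun0 linU).
(* Covariance at the vector [U g x] reads [U g (E X x) = E (g X) (U g x) = 0], and the adjoint then
   cancels [U g]. *)
apply/funext => x; have := congr1 (@^~ (U g x)) (UE g X mX).
rewrite EgX /= -[adjoint (U g) (U g x)]/((adjoint (U g) \o U g) x) UU /=.
move=> /(congr1 (adjoint (U g))); rewrite adj0.
by rewrite -[adjoint (U g) (U g _)]/((adjoint (U g) \o U g) _) UU.
Qed.

Lemma povm_measure_null chi (X : set (borel S)) : trace_class chi ->
  measurable X -> mu X = 0%E -> povm_measure E chi X = 0.
Proof.
move=> tchi mX muX.
rewrite -(povm_measure_set0 Hsep HE tchi) /povm_measure.
by have [_ -> _] := HE; rewrite covariant_povm_null.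
Qed.

Lemma povm_measure_RN chi : trace_class chi ->
  exists f : borel S -> R[i], is_RN_derivative mu (povm_measure E chi) f.
Proof.
move=> tchi.
have [|fr [fri frE]] := @Radon_Nikodym_real _ _ _
  [the {charge set (borel S) -> \bar R} of povm_charge_Re HE Hsep tchi] mu mu_sfin.
  apply/null_content_dominatesP => X mX muX.
  by rewrite /= /povm_charge_Re povm_measure_null.
have [|fi [fii fiE]] := @Radon_Nikodym_real _ _ _
  [the {charge set (borel S) -> \bar R} of povm_charge_Im HE Hsep tchi] mu mu_sfin.
  apply/null_content_dominatesP => X mX muX.
  by rewrite /= /povm_charge_Im povm_measure_null.
exists (fun x => fr x +i* fi x); split => // A mA.
have [ReA] := frE A mA; have [ImA] := fiE A mA.
rewrite /complex_integral /= -ReA -ImA.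
by case: (povm_measure E chi A).
Qed.

(** The symmetric decomposition of [chi] gives a series with terms [<E X u_j, u_j>], all
    nonnegative. *)
Lemma povm_measure_ge0 chi (X : set (borel S)) : trace_class chi ->
  positive_op chi -> measurable X -> 0 <= povm_measure E chi X.
Proof.
move=> tchi pchi mX; have [effE _ _] := HE; have [bE pE _] := effE X mX.
have [v [w vw]] := trace_class_nuclear tchi.
have [u uu] := positive_trace_class_nuclear pchi tchi.1 vw Hsep.
have := trace_nuclear Hsep uu bE; rewrite -/(povm_measure E chi X).
have -> : (fun n => \sum_(0 <= j < n) '[E X (u j), u j]) =
    (fun n => (\sum_(0 <= j < n) qform (E X) (u j))%:C).
  apply/funext => n; rewrite rmorph_sum; apply: eq_bigr => j _.
  by rewrite /= (qformE pE).
move=> /cvg_complexP[/= cRe cIm].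
rewrite lecE /=; apply/andP; split.
  apply/eqP; rewrite -(cvg_lim (@Rhausdorff R) cIm).
  by apply/cvg_lim => //; exact: cvg_cst.
rewrite -(cvg_lim (@Rhausdorff R) cRe); apply: limr_ge.
  by apply/cvg_ex; eexists; exact: cRe.
by apply: nearW => n; apply: sumr_ge0 => j _; exact: qform_ge0.
Qed.

End CovariantPOVM.

Section Positivity.
Context {d} {T : measurableType d} {R : realType}.
Variable mu : {measure set T -> \bar R}.

(** In [R[i]], [0 <= f x] also asserts that the imaginary part vanishes; this comes from the sign
    argument applied to the imaginary part and to its opposite. *)
Lemma RN_derivative_ge0 (nu : set T -> R[i]) (f : T -> R[i]) :
  is_RN_derivative mu nu f -> (forall A, measurable A -> 0 <= nu A) ->
  {ae mu, forall x, 0 <= f x}.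
Proof.
move=> [[fr fi] nuE] nu0.
have h A : measurable A -> (\int[mu]_(x in A) complex.Im (f x) == 0)%R &&
    (0 <= \int[mu]_(x in A) complex.Re (f x))%R.
  by move=> mA; have := nu0 A mA; rewrite nuE// /complex_integral lecE.
have Re0 : {ae mu, forall x, 0 <= complex.Re (f x)}.
  by apply: ae_ge0_of_integral_ge0 => // A /h/andP[].
have Im0 : {ae mu, forall x, 0 <= complex.Im (f x)}.
  by apply: ae_ge0_of_integral_ge0 => // A /h/andP[/eqP ->].
have Im0' : {ae mu, forall x, 0 <= - complex.Im (f x)}.
  apply: (@ae_ge0_of_integral_ge0 _ _ _ _ (fun x => - complex.Im (f x))).
    exact: integrableN fi.
  move=> A mA.
  have := @RintegralZl _ _ _ mu A (fun x => complex.Im (f x)) (-1) mA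
    (integrableS measurableT mA (@subsetT _ _) fi).
  under eq_Rintegral do rewrite mulN1r.
  by move=> ->; have /andP[/eqP -> _] := h A mA; rewrite mulr0.
apply: filterS3 Re0 Im0 Im0' => x re im im'.
by rewrite lecE /= re andbT eq_le -oppr_ge0 im im'.
Qed.

End Positivity.
Theorem theorem3p20 (R : realType) (H : hilbertType R) (Hsep : separable H)
    (G : topologicalGroupType) (Glc : locally_compact [set: G])
    (Gsc : @second_countable G) (Ghaus : hausdorff_space G)
    (K : groupClosed G) (Kclosed : closed [set g : G | g \in K])
    (S : ptopologicalType) (Slc : locally_compact [set: S])
    (Ssc : @second_countable S)
    (act : G -> S -> S) (act_cont : continuous_action act)
    (act_trans : transitive_action act) (SGK : isomorphic_to_cosets K act)
    (mu : {measure set (borel S) -> \bar R})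
    (mu_sfin : sigma_finite [set: borel S] mu)
    (mu_neq0 : mu [set: borel S] <> 0%E)
    (mu_qinv : quasi_invariant act mu)
    (E : set (borel S) -> H -> H)
    (E_povm : normalized_povm E) (E_cov : covariant E act) :
  (forall X : set (borel S), measurable X -> mu X = 0%E -> E X = (fun=> 0)) /\
  (forall chi : H -> H, trace_class chi ->
    (exists f : borel S -> R[i],
       is_RN_derivative mu (povm_measure E chi) f) /\
    (forall f : borel S -> R[i],
       is_RN_derivative mu (povm_measure E chi) f ->
       (positive_op chi -> {ae mu, forall x, 0 <= f x}) /\
       (trace chi = 1 -> complex_integral mu [set: borel S] f = 1))).

Proof.
have [HE E1] := E_povm; split.
  by move=> X mX muX; apply: (@covariant_povm_null _ _ _ _ act E mu).
move=> chi tchi; split.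
  exact: (@povm_measure_RN _ _ _ _ act E mu).
move=> f fRN; split.
  move=> pchi; apply: (RN_derivative_ge0 fRN) => A mA.
  exact: (povm_measure_ge0 Hsep HE tchi pchi mA).
move=> trchi; have [_ /(_ setT measurableT) <-] := fRN.
by rewrite /povm_measure E1.
Qed.
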